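(* Let $B$ be a $\wp$-adic ring and let $E$ be a Drinfeld module of rank two over $B$ with ordinary reduction. Then, for any positive integer $n$, there exists a unique finite locally free closed $A$-submodule scheme $\mathcal{C}_n(E)$ of $E[\wp^n]$ over $B$ whose reduction $\overline{\mathcal{C}_n(E)}=\mathcal{C}_n(E)\times_B \mathrm{Spec}(B/\wp B)$ equals $\mathrm{Ker}(F_{d,\bar E}^n)$. Moreover, the formation of $\mathcal{C}_n(E)$ commutes with any base change $B\to B'$ of $\wp$-adic rings.
   Context: Let $p$ be a prime, $q$ a power of $p$, $A=\mathbb{F}_q[t]$, $\wp\in A$ a monic irreducible polynomial of degree $d$, and $\mathcal{O}_K$ the completion of $A$ at $(\wp)$. An $\mathcal{O}_K$-algebra $B$ is a $\wp$-adic ring if it is $\wp$-adically complete. Put $\bar B=B/\wp B$, and $\bar X=X\times_B\mathrm{Spec}(\bar B)$ for a $B$-scheme $X$. For a scheme $S$ over $A$, $\theta\in\mathcal{O}_S(S)$ is the image of $t$. For an invertible $\mathcal{O}_S$-module $\mathcal{L}$, $\mathbb{V}_*(\mathcal{L})=\mathrm{Spec}_S(\mathrm{Sym}(\mathcal{L}^{\otimes -1}))$ is the line bundle with $T$-points $\mathcal{L}|_T(T)$, and $\tau:\mathbb{V}_*(\mathcal{L})\to\mathbb{V}_*(\mathcal{L}^{\otimes q})$ is $l\mapsto l^{\otimes q}$. A Drinfeld module of rank $r$ over $S$ is a pair $E=(\mathcal{L},\Phi^E)$ with $\Phi^E:A\to\mathrm{End}_S(\mathbb{V}_*(\mathcal{L}))$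 an $\mathbb{F}_q$-algebra homomorphism such that for $a\ne0$, $\Phi^E_a=\sum_{i=0}^{r\deg(a)}\alpha_i(a)\tau^i$ with $\alpha_i(a)\in\mathcal{L}^{\otimes 1-q^i}(S)$, $\alpha_{r\deg(a)}(a)$ nowhere vanishing, and $\alpha_0(a)$ the image of $a$ in $\mathcal{O}_S(S)$; $E$ also denotes the $A$-module scheme $\mathbb{V}_*(\mathcal{L})$, and $E[a]$ its $a$-torsion. If $\wp=0$ on $S$ and $E$ has rank two, then one can write $\Phi^E_\wp=(\alpha_d+\cdots+\alpha_{2d}\tau^d)\tau^d$. Put $F_{d,E}=\tau^d:E\to E^{(q^d)}$ (here $(q^d)$ denotes base change by the $q^d$-th power Frobenius of $S$), and let $F_{d,E}^n:E\to E^{(q^{dn})}$ be the $n$-fold iterate, $F_d^1=F_d$, $F_d^n=(F_d^{n-1})^{(q^d)}\circ F_d$. $E$ is ordinary if $\alpha_d\in\mathcal{L}^{\otimes 1-q^d}(S)$ is nowhere vanishing. A rank two Drinfeld module $E$ over an $\mathcal{O}_K$-algebra $B$ has ordinary reduction if $\bar E$ is ordinary. *)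

(* Defs.v *)
From HB Require Import structures.
From mathcomp Require Import all_boot all_order all_algebra.
From mathcomp Require Import boolp classical_sets.

Set Implicit Arguments.
Unset Strict Implicit.
Unset Printing Implicit Defensive.

Import GRing.Theory.
Local Open Scope classical_set_scope.
Local Open Scope ring_scope.

(* Every scheme below is affine over an affine base, and is given by its      *)
(* coordinate ring; closed subschemes are ideals.  Rings are allowed to be    *)
(* zero (comPzRingType), and B-algebras are ring morphisms out of B, since    *)
(* MathComp's comAlgType excludes the zero ring.                              *)

Section Ideals.
Variable S : comPzRingType.

Definition is_ideal (J : set S) : Prop :=
  [/\ J 0, forall x y, J x -> J y -> J (x + y) & forall s x, J x -> J (s * x)].

Definition ideal_gen (X : set S) : set S := smallest is_ideal X.

Definition principal (a : S) : set S := [set x | exists c, x = a * c].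

Definition prime_ideal (P : set S) : Prop :=
  [/\ is_ideal P, ~ P 1 & forall x y, P (x * y) -> P x \/ P y].

(* S -> lim_n S/(w^n) is injective, respectively surjective. *)
Definition adically_complete (w : S) : Prop :=
  (forall x, (forall n, principal (w ^+ n) x) -> x = 0) /\
  (forall u : nat -> S, (forall n, principal (w ^+ n) (u n.+1 - u n)) ->
     exists l, forall n, principal (w ^+ n) (l - u n)).

End Ideals.

(* O is w-adically complete and A/(w^n) -> O/(w^n) is an isomorphism for all n. *)
Definition is_adic_completion (A O : comPzRingType) (w : A)
    (j : {rmorphism A -> O}) : Prop :=
  adically_complete (j w) /\
  (forall n, (forall a, principal (j w ^+ n) (j a) -> principal (w ^+ n) a) /\
             (forall x, exists a, principal (j w ^+ n) (x - j a))).

Definition is_quotient_by (B Bbar : comPzRingType) (w : B)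
    (pi : {rmorphism B -> Bbar}) : Prop :=
  (forall y, exists x, pi x = y) /\ (forall x, pi x = 0 <-> principal w x).

Section LocallyFree.
Variables (B : comPzRingType) (M : zmodType) (act : B -> M -> M) (K : set M).

(* (M/K)_f is free of rank r over B_f: multiplying a basis by a power of f,   *)
(* it may be taken in the image of M, and denominators have been cleared.     *)
Definition free_after_inverting (f : B) (r : nat) : Prop :=
  exists e : 'I_r -> M,
    (forall x, exists m (b : 'I_r -> B),
       K (act (f ^+ m) x - \sum_(i < r) act (b i) (e i))) /\
    (forall b : 'I_r -> B, K (\sum_(i < r) act (b i) (e i)) ->
       exists m, forall i, f ^+ m * b i = 0).

(* M/K is locally free over Spec B, with all local ranks in [ranks]; the      *)
(* basic open sets D(f i) cover Spec B.                                       *)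
Definition locally_free (ranks : set nat) : Prop :=
  exists k (f c : 'I_k -> B), \sum_(i < k) c i * f i = 1 /\
    forall i, exists2 r, ranks r & free_after_inverting (f i) r.

End LocallyFree.

Section SymmetricAlgebra.
Variables (B : comPzRingType) (L : lmodType B).

(* h is a B-linear map from the dual module L^{-1} = Hom_B(L, B) = {scalar L} *)
(* to T; sums and multiples of linear forms are taken pointwise.              *)
Definition linear_on_dual (T : comPzRingType) (t : B -> T)
    (h : {scalar L} -> T) : Prop :=
  forall (b : B) (f g k : {scalar L}),
    (forall v, k v = b * f v + g v) -> h k = t b * h f + h g.

(* (S, str, iota) is the symmetric algebra of L^{-1}. *)
Definition is_symmetric_algebra (S : comPzRingType) (str : {rmorphism B -> S})
    (iota : {scalar L} -> S) : Prop :=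
  linear_on_dual str iota /\
  forall (T : comPzRingType) (t : {rmorphism B -> T}) (h : {scalar L} -> T),
    linear_on_dual t h ->
    exists2 x : {rmorphism S -> T},
      (forall b, x (str b) = t b) /\ (forall f, x (iota f) = h f) &
      forall y : {rmorphism S -> T},
        (forall b, y (str b) = t b) -> (forall f, y (iota f) = h f) -> y =1 x.

End SymmetricAlgebra.

(* An invertible module L together with the coordinate ring Sym(L^{-1}) of    *)
(* the line bundle V_*(L).                                                    *)
Record line_bundle (B : comPzRingType) := LineBundle {
  lb_mod : lmodType B;
  lb_invertible : locally_free (fun b (v : lb_mod) => b *: v) [set 0] [set 1%N];
  lb_ring : comPzRingType;
  lb_str : {rmorphism B -> lb_ring};
  lb_coord : {scalar lb_mod} -> lb_ring;
  lb_sym : is_symmetric_algebra lb_str lb_coord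
}.

Section LineBundle.
Variables (B : comPzRingType) (V : line_bundle B).

(* Sym^m(L^{-1}) = L^{-m} inside Sym(L^{-1}). *)
Definition sym_degree (m : nat) : set (lb_ring V) :=
  [set s | exists k (b : 'I_k -> B) (f : 'I_k -> 'I_m -> {scalar (lb_mod V)}),
     s = \sum_(i < k) lb_str V (b i) * \prod_(l < m) lb_coord (f i l)].

(* For s in L^{-m}: s is nonzero in L^{-m} (x) k(P) for every point P of      *)
(* Spec B.  That space is a summand of Sym(L^{-1}) (x) k(P), in which s is    *)
(* zero iff u s lies in P.Sym(L^{-1}) for some u outside P.                   *)
Definition nowhere_vanishing (s : lb_ring V) : Prop :=
  forall P : set B, prime_ideal P ->
    ~ exists2 u, ~ P u & ideal_gen (lb_str V @` P) (lb_str V u * s).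

End LineBundle.

Section DrinfeldModules.
Variable F : finFieldType.
Local Notation q := #|F|.

Definition pdeg (a : {poly F}) : nat := (size a).-1.

(* dm_phi a is the comorphism of Phi_a : V_*(L) -> V_*(L).  A section alpha   *)
(* of L^{1 - q^i} is an element of Sym^{q^i - 1}(L^{-1}), and the comorphism  *)
(* of alpha tau^i sends a linear form f to f(alpha l^{q^i}) = alpha f, an     *)
(* element of Sym^{q^i}(L^{-1}).  For a = 0 or i > r deg(a), the value of     *)
(* dm_coef a i is irrelevant.                                                 *)
Record drinfeld_module (r : nat) (B : comPzRingType)
    (gamma : {rmorphism {poly F} -> B}) := DrinfeldModule {
  dm_lb :> line_bundle B;
  dm_phi : {poly F} -> {rmorphism lb_ring dm_lb -> lb_ring dm_lb};
  dm_coef : {poly F} -> nat -> lb_ring dm_lb;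
  dm_phi_str : forall a b, dm_phi a (lb_str dm_lb b) = lb_str dm_lb b;
  dm_phiC : forall (c : F) f,
    dm_phi c%:P (lb_coord f) = lb_str dm_lb (gamma c%:P) * lb_coord f;
  dm_phiD : forall a b f,
    dm_phi (a + b) (lb_coord f)
      = dm_phi a (lb_coord f) + dm_phi b (lb_coord f);
  dm_phiM : forall a b s, dm_phi (a * b) s = dm_phi b (dm_phi a s);
  dm_coef_degree : forall a i, a != 0 -> (i <= r * pdeg a)%N ->
    sym_degree (q ^ i - 1) (dm_coef a i);
  dm_phiE : forall a f, a != 0 ->
    dm_phi a (lb_coord f)
      = \sum_(i < (r * pdeg a).+1) dm_coef a i * lb_coord f;
  dm_coef0 : forall a, a != 0 -> dm_coef a 0 = lb_str dm_lb (gamma a);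
  dm_coef_lead : forall a, a != 0 ->
    nowhere_vanishing (dm_coef a (r * pdeg a))
}.

Section OneModule.
Variables (r : nat) (B : comPzRingType) (gamma : {rmorphism {poly F} -> B}).
Variable E : drinfeld_module r gamma.

(* The ideal of E[a], the inverse image under Phi_a of the zero section,      *)
(* whose ideal is generated by the linear forms.                              *)
Definition torsion_ideal (a : {poly F}) : set (lb_ring E) :=
  ideal_gen (range (fun f => dm_phi E a (lb_coord f))).

(* The ideal of Ker(F_d^n).  The twist E^{(q^d)} is V_*(L^{(q^d)}), and the   *)
(* comorphism of F_d sends the pulled back form f (x) 1 to the q^d-th power   *)
(* of f.  Meaningful when B has characteristic p.                             *)
Definition frobenius_kernel_ideal (d n : nat) : set (lb_ring E) :=
  ideal_gen (range (fun f => iter n (fun s => s ^+ (q ^ d)) (lb_coord f))).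

(* The closed subscheme of E defined by J is stable under the A-module        *)
(* operations of E on T-points, i.e. on ring morphisms lb_ring E -> T         *)
(* inducing a given B-algebra structure on T.  Opposites are Phi_{-1}.        *)
Definition is_submodule_scheme (J : set (lb_ring E)) : Prop :=
  forall T : comPzRingType,
  let on_J (x : {rmorphism lb_ring E -> T}) := forall s, J s -> x s = 0 in
  [/\ forall z : {rmorphism lb_ring E -> T},
        (forall f, z (lb_coord f) = 0) -> on_J z,
      forall x y z : {rmorphism lb_ring E -> T},
        (forall b, y (lb_str E b) = x (lb_str E b)) ->
        (forall b, z (lb_str E b) = x (lb_str E b)) ->
        (forall f, z (lb_coord f) = x (lb_coord f) + y (lb_coord f)) ->
        on_J x -> on_J y -> on_J z &
      forall (a : {poly F}) (x : {rmorphism lb_ring E -> T}),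
        on_J x -> forall s, J s -> x (dm_phi E a s) = 0].

(* J is the ideal of a finite locally free closed A-submodule scheme of E[a]. *)
Definition is_flf_submodule_of_torsion (a : {poly F})
    (J : set (lb_ring E)) : Prop :=
  [/\ is_ideal J, torsion_ideal a `<=` J,
      locally_free (fun b (s : lb_ring E) => lb_str E b * s) J setT &
      is_submodule_scheme J].

End OneModule.

Arguments torsion_ideal {r B gamma} E a.
Arguments frobenius_kernel_ideal {r B gamma} E d n.

(* Only meant for bases on which wp = 0. *)
Definition ordinary (wp : {poly F}) (B : comPzRingType)
    (gamma : {rmorphism {poly F} -> B}) (E : drinfeld_module 2 gamma) : Prop :=
  nowhere_vanishing (dm_coef E wp (pdeg wp)).

(* E' is the base change of E along phi: L' = L (x)_B B' via lam, the linear  *)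
(* form f of L induces the form f' of L' with f' o lam = phi o f, and g is    *)
(* the comorphism of the projection V_*(L') -> V_*(L).                        *)
Definition is_base_change (r : nat) (B B' : comPzRingType)
    (gamma : {rmorphism {poly F} -> B}) (gamma' : {rmorphism {poly F} -> B'})
    (phi : {rmorphism B -> B'})
    (E : drinfeld_module r gamma) (E' : drinfeld_module r gamma')
    (g : {rmorphism lb_ring E -> lb_ring E'}) : Prop :=
  let semilinear (M : lmodType B') (h : lb_mod E -> M) :=
    forall b v w, h (b *: v + w) = phi b *: h v + h w in
  exists lam : lb_mod E -> lb_mod E',
  [/\ semilinear _ lam,
      forall (M : lmodType B') (h : lb_mod E -> M), semilinear M h ->
        exists2 h' : {linear lb_mod E' -> M}, (forall v, h' (lam v) = h v) &
          forall k : {linear lb_mod E' -> M},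
            (forall v, k (lam v) = h v) -> k =1 h',
      forall b, g (lb_str E b) = lb_str E' (phi b),
      forall (f : {scalar (lb_mod E)}) (f' : {scalar (lb_mod E')}),
        (forall v, f' (lam v) = phi (f v)) -> g (lb_coord f) = lb_coord f' &
      forall a s, g (dm_phi E a s) = dm_phi E' a (g s)].

(* C is (the ideal of) C_n(E); Ebar is the reduction of E modulo wp and rho   *)
(* the comorphism of Ebar -> E, so that ideal_gen (rho @` C) is the ideal of  *)
(* the reduction of C.                                                        *)
Definition is_canonical_subgroup (wp : {poly F}) (n : nat)
    (B Bbar : comPzRingType) (gamma : {rmorphism {poly F} -> B})
    (gammabar : {rmorphism {poly F} -> Bbar})
    (E : drinfeld_module 2 gamma) (Ebar : drinfeld_module 2 gammabar)
    (rho : {rmorphism lb_ring E -> lb_ring Ebar})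
    (C : set (lb_ring E)) : Prop :=
  is_flf_submodule_of_torsion (wp ^+ n) C /\
  ideal_gen (rho @` C) = frobenius_kernel_ideal Ebar (pdeg wp) n.

End DrinfeldModules.

(* Main.v *)
(* Let w be the image of wp in B, N = q^(nd) and D = q^(2nd).  The torsion     *)
(* scheme E[wp^n] is finite locally free of rank D, its algebra R is w-adic,   *)
(* and modulo w its equation has the form u x^N (1 - eta), where u is          *)
(* invertible because E is ordinary and eta is divisible by x^N.  So eta is    *)
(* idempotent in R/wR and cuts out Ker(F_d^n); it lifts to an idempotent eps   *)
(* of R, and C_n(E) is the locus eps = 0.                                      *)
(* By Nakayama's lemma, an idempotent divisible by w in a B-algebra that is a  *)
(* finite B-module is zero.  Applied to the images of eps under the A-module   *)
(* operations, this shows that C_n(E) is a submodule scheme; applied to the    *)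
(* algebra of another lift of Ker(F_d^n), that this lift lies in C_n(E), and   *)
(* equality follows from flatness.  Base change is clear, since the conditions *)
(* on eps are preserved.                                                       *)
(* L is not assumed to be trivial: functions on V_*(L) are studied through     *)
(* their restrictions to the lines x |-> x e_i, where the sections e_i of L    *)
(* generate it on the members of an open cover of Spec B.                      *)

Require Import Defs.
From HB Require Import structures.
From mathcomp Require Import all_boot all_order all_algebra.
From mathcomp Require Import boolp classical_sets.
From mathcomp Require Import pgroup abelian finfield qfpoly.
From mathcomp Require Import ring zify.

Set Implicit Arguments.
Unset Strict Implicit.
Unset Printing Implicit Defensive.

Import GRing.Theory.
Local Open Scope classical_set_scope.
Local Open Scope ring_scope.

(** * Ideals *)

(** Put N = q^(nd), D = q^(2nd), M = D - N, and let w be the image of [wp]. A term alpha tau^i pulls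
    a linear form f back to alpha f, so Phi of [wp ^+ n] multiplies linear forms by one function
    beta = [multiplier E (wp ^+ n)], of degree D - 1 with invertible top part, and E[wp^n] is cut
    out by the products beta f. By division with remainder ([torsion_reducible], [torsion_deg_lt0])
    the functions on E[wp^n] are represented uniquely in degree < D. Hence their algebra R is finite
    over B and w-adically separated, and idempotents lift from R/wR to R ([idempotent_lift]).

    Modulo w, the coefficients of Phi_wp below tau^d vanish ([coef_wp_small]) and that of tau^d is
    nowhere zero by ordinarity. So beta = u (1 - eta) modulo w, with u nowhere vanishing of degree N
    - 1 and eta in the ideal of the N-th powers X^N of the coordinates. Then X^N (1 - eta) = 0 in
    R/wR, so eta is idempotent there and generates the ideal of Ker(F_d^n)
    ([canonical_idempotent_exists]). A lift eps of eta splits E[wp^n] into the locus eps = 0, which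
    is C_n(E), and its complement. These are spanned in degrees < N and < M; as N + M = D, this
    leaves no room for relations, and C_n(E) is locally free of rank N ([component_locally_free]).

    The rest is rigidity. A torsion point z with values in a finite algebra lies on C_n(E) as soon
    as z(X^N) is divisible by w in that algebra ([component_vanish]); this condition passes to sums,
    N being a power of q, and is preserved by every Phi_a. The same use of Nakayama's lemma, with
    the projectivity of the quotient, compares C_n(E) with any other lift ([component_unique]). The
    properties in [canonical_idempotent] survive base change, so [canonical_subgroupP], applied over
    B and over B', yields all assertions. *)

Section IdealTheory.
Variable S : comPzRingType.
Implicit Types (J K : set S) (X : set S) (x y s w : S).

Section OneIdeal.
Variables (J : set S) (J_ideal : is_ideal J).

Lemma ideal0 : J 0. Proof. by case: J_ideal. Qed.

Lemma idealD x y : J x -> J y -> J (x + y).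
Proof. by case: J_ideal => _ + _; apply. Qed.

Lemma idealMl s x : J x -> J (s * x).
Proof. by case: J_ideal => _ _; apply. Qed.

Lemma idealMr s x : J x -> J (x * s).
Proof. by rewrite mulrC; apply: idealMl. Qed.

Lemma idealN x : J x -> J (- x).
Proof. by rewrite -mulN1r; apply: idealMl. Qed.

Lemma idealB x y : J x -> J y -> J (x - y).
Proof. by move=> Jx Jy; apply: idealD => //; apply: idealN. Qed.

Lemma ideal_trans y x z : J (x - y) -> J (y - z) -> J (x - z).
Proof. by move=> Jxy Jyz; rewrite -(subrK y x) -addrA; apply: idealD. Qed.

Lemma idealM_cong x1 x2 y1 y2 :
  J (x1 - x2) -> J (y1 - y2) -> J (x1 * y1 - x2 * y2).
Proof.
move=> Jx Jy.
have -> : x1 * y1 - x2 * y2 = y1 * (x1 - x2) + x2 * (y1 - y2) by ring.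
by apply: idealD; apply: idealMl.
Qed.

Lemma ideal_sum (I : Type) (r : seq I) (P : pred I) (F : I -> S) :
  (forall i, P i -> J (F i)) -> J (\sum_(i <- r | P i) F i).
Proof. by move=> JF; elim/big_ind: _ => //; [apply: ideal0 | apply: idealD]. Qed.

End OneIdeal.

Lemma ideal_gen_ideal X : is_ideal (ideal_gen X).
Proof.
split=> [K [[K0 _ _] _] //|x y Xx Xy K [Ki XK]|s x Xx K [Ki XK]].
  by apply: idealD => //; [apply: Xx | apply: Xy].
by apply: idealMl => //; apply: Xx.
Qed.

Lemma sub_ideal_gen X : X `<=` ideal_gen X.
Proof. by move=> x Xx K [_]; apply. Qed.

Lemma ideal_gen_min X J : is_ideal J -> X `<=` J -> ideal_gen X `<=` J.
Proof. by move=> Ji XJ x; apply. Qed.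

Lemma principal_ideal w : is_ideal (principal w).
Proof.
split=> [|x y [c ->] [d ->]|s x [c ->]]; first by exists 0; rewrite mulr0.
  by exists (c + d); rewrite mulrDr.
by exists (s * c); rewrite mulrCA.
Qed.

Lemma principal_mul w s : principal w (w * s). Proof. by exists s. Qed.

Definition ideal_add J K : set S := [set s | exists x y, [/\ J x, K y & s = x + y]].

Lemma ideal_add_ideal J K : is_ideal J -> is_ideal K -> is_ideal (ideal_add J K).
Proof.
move=> Ji Ki; split.
- by exists 0, 0; rewrite addr0; split=> //; apply: ideal0.
- move=> _ _ [x1 [y1 [Jx1 Ky1 ->]]] [x2 [y2 [Jx2 Ky2 ->]]].
  by exists (x1 + x2), (y1 + y2); rewrite addrACA; split=> //; apply: idealD.
- move=> s _ [x [y [Jx Ky ->]]]; exists (s * x), (s * y); rewrite mulrDr.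
  by split=> //; apply: idealMl.
Qed.

Lemma ideal_addl J K x : is_ideal K -> J x -> ideal_add J K x.
Proof. by move=> Ki Jx; exists x, 0; rewrite addr0; split=> //; apply: ideal0. Qed.

Lemma ideal_addr J K x : is_ideal J -> K x -> ideal_add J K x.
Proof. by move=> Ji Kx; exists 0, x; rewrite add0r; split=> //; apply: ideal0. Qed.

Lemma ideal_add_min J K L :
  is_ideal L -> J `<=` L -> K `<=` L -> ideal_add J K `<=` L.
Proof. by move=> Li JL KL _ [x [y [/JL ? /KL ? ->]]]; apply: idealD. Qed.

Lemma exists_prime_ideal J : is_ideal J -> ~ J 1 ->
  exists2 P : set S, prime_ideal P & J `<=` P.
Proof.
move=> Ji J1.
pose proper (A : set S) := [/\ is_ideal A, J `<=` A & ~ A 1].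
have [F FP Ftot|A [[A0|[Ai JA A1]] Amax]] :=
  @Zorn_bigcup S [set A | A = set0 \/ proper A].
- have [[A FA A0]|F0] := pselect (exists2 A, F A & A !=set0); last first.
    left; rewrite -subset0 => x [A FA Ax].
    by apply: F0; exists A => //; exists x.
  have FPne X x : F X -> X x -> proper X.
    by move=> FX Xx; case: (FP _ FX) => // X0; rewrite X0 in Xx.
  case: A0 => a Aa; right; split; last 2 first.
  - by move=> x Jx; exists A => //; case: (FPne _ _ FA Aa) => _ + _; apply.
  - by case=> X FX X1; case: (FPne _ _ FX X1).
  split=> [|x y [X FX Xx] [Y FY Yy]|s x [X FX Xx]].
  + by exists A => //; case: (FPne _ _ FA Aa) => Ai _ _; apply: ideal0.
  + have [Xi _ _] := FPne _ _ FX Xx; have [Yi _ _] := FPne _ _ FY Yy.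
    case: (Ftot _ _ FX FY) => [XY|YX].
      by exists Y => //; apply: idealD => //; apply: XY.
    by exists X => //; apply: idealD => //; apply: YX.
  + have [Xi _ _] := FPne _ _ FX Xx.
    by exists X => //; apply: idealMl.
- exfalso; apply: (Amax J); last by right; split.
  by rewrite A0; split=> // sub; apply: (sub 0); apply: ideal0.
- exists A => //; split=> // x y Axy.
  have [Ax|nAx] := pselect (A x); [by left | right].
  have AKi := ideal_add_ideal Ai (principal_ideal x).
  have [[a [_ [Aa [c ->]] e1]]|nK1] :=
      pselect (ideal_add A (principal x) 1).
    rewrite -(mul1r y) e1 mulrDl mulrAC; apply: idealD => //; first exact: idealMr.
    exact: idealMr.
  exfalso; apply: (Amax (ideal_add A (principal x))).
    split=> [z Az|sub]; first exact: (ideal_addl (principal_ideal x)).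
    by apply/nAx/sub/ideal_addr => //; exists 1; rewrite mulr1.
  right; split=> // z Jz; apply: (ideal_addl (principal_ideal x)); exact: JA.
Qed.

Lemma prime_idealX (P : set S) x m : prime_ideal P -> P (x ^+ m) -> P x.
Proof.
case=> _ P1 PM; elim: m => [|m IHm]; first by rewrite expr0.
by rewrite exprS => /PM[].
Qed.

(** A prime containing J would contain every a i, hence 1. This glues all statements proved on the
    open sets D(a i), with J an annihilator or a conductor. *)
Lemma local_to_global (k : nat) (a c : 'I_k -> S) J :
  \sum_(i < k) c i * a i = 1 -> is_ideal J ->
  (forall i, exists m, J (a i ^+ m)) -> J 1.
Proof.
move=> ca1 Ji Ja; apply: contrapT => J1.
have [P Pp JP] := exists_prime_ideal Ji J1.
have [Pi P1 _] := Pp; apply: P1; rewrite -ca1; apply: ideal_sum => // i _.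
apply: idealMl => //; have [m /JP] := Ja i; exact: prime_idealX.
Qed.

(** The inverse is the limit of a geometric series. Thus w lies in the Jacobson radical, which is
    the form in which [nakayama] uses completeness. *)
Lemma complete_unit w : adically_complete w ->
  forall b, exists u, u * (1 + w * b) = 1.
Proof.
case=> sep lim b; pose v n := \sum_(i < n) (- (w * b)) ^+ i.
have vS n : principal (w ^+ n) (v n.+1 - v n).
  rewrite /v big_ord_recr /= addrAC subrr add0r -mulrN exprMn.
  exact: principal_mul.
have [l lP] := lim v vS; exists l.
apply/eqP; rewrite -subr_eq0; apply/eqP; apply: sep => n.
set z := - (w * b).
have vE : v n * (1 + w * b) - 1 = - z ^+ n.
  have -> : 1 + w * b = - (z - 1) by rewrite /z; ring.
  by rewrite mulrN mulrC -subrX1; ring.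
have -> : l * (1 + w * b) - 1 = (l - v n) * (1 + w * b) - z ^+ n.
  by rewrite mulrBl -addrA -vE; ring.
apply: idealB; first exact: principal_ideal.
  by apply: idealMr (lP n); apply: principal_ideal.
by rewrite /z -mulrN exprMn; apply: principal_mul.
Qed.

End IdealTheory.

(** * Modules over the base *)

Section Modules.
Variables (B : comPzRingType) (M : zmodType) (act : B -> M -> M).

Definition is_action : Prop :=
  [/\ forall x, act 1 x = x,
      forall a b x, act (a * b) x = act a (act b x),
      forall a x y, act a (x + y) = act a x + act a y &
      forall a b x, act (a + b) x = act a x + act b x].

Definition is_submodule (K : set M) : Prop :=
  [/\ K 0, forall x y, K x -> K y -> K (x + y) & forall b x, K x -> K (act b x)].

Hypothesis actP : is_action.

Lemma act1 x : act 1 x = x. Proof. by case: actP. Qed.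
Lemma actM a b x : act (a * b) x = act a (act b x). Proof. by case: actP. Qed.
Lemma actDr a x y : act a (x + y) = act a x + act a y. Proof. by case: actP. Qed.
Lemma actDl a b x : act (a + b) x = act a x + act b x. Proof. by case: actP. Qed.

Lemma act0r a : act a 0 = 0.
Proof. by apply: (addIr (act a 0)); rewrite -actDr !add0r. Qed.

Lemma act0l x : act 0 x = 0.
Proof. by apply: (addIr (act 0 x)); rewrite -actDl !add0r. Qed.

Lemma actNr a x : act a (- x) = - act a x.
Proof. by apply: (addIr (act a x)); rewrite -actDr !addNr act0r. Qed.

Lemma actNl a x : act (- a) x = - act a x.
Proof. by apply: (addIr (act a x)); rewrite -actDl !addNr act0l. Qed.

Lemma actBr a x y : act a (x - y) = act a x - act a y.
Proof. by rewrite actDr actNr. Qed.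

Lemma actC a b x : act a (act b x) = act b (act a x).
Proof. by rewrite -!actM mulrC. Qed.

Lemma act_sumr a (I : Type) (r : seq I) P (F : I -> M) :
  act a (\sum_(i <- r | P i) F i) = \sum_(i <- r | P i) act a (F i).
Proof. by apply: big_morph => [x y|]; rewrite ?actDr ?act0r. Qed.

Lemma act_suml x (I : Type) (r : seq I) P (F : I -> B) :
  act (\sum_(i <- r | P i) F i) x = \sum_(i <- r | P i) act (F i) x.
Proof. by apply: (big_morph (act^~ x)) => [a b|]; rewrite ?actDl ?act0l. Qed.

Section OneSubmodule.
Variables (K : set M) (K_sub : is_submodule K).

Lemma submod0 : K 0. Proof. by case: K_sub. Qed.

Lemma submodD x y : K x -> K y -> K (x + y).
Proof. by case: K_sub => _ + _; apply. Qed.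

Lemma submodZ b x : K x -> K (act b x).
Proof. by case: K_sub => _ _; apply. Qed.

Lemma submodN x : K x -> K (- x).
Proof. by move=> Kx; rewrite -(act1 x) -actNl; apply: submodZ. Qed.

Lemma submodBC x y : K (x - y) -> K (y - x).
Proof. by move=> /submodN; rewrite opprB. Qed.

Lemma submod_trans y x z : K (x - y) -> K (y - z) -> K (x - z).
Proof. by move=> Kxy Kyz; rewrite -(subrK y x) -addrA; apply: submodD. Qed.

Lemma submodD_cancel x y : K (x - y) -> K y -> K x.
Proof. by move=> Kxy Ky; rewrite -(subrK y x); apply: submodD. Qed.

Lemma submod_sum (I : Type) (r : seq I) (P : pred I) (F : I -> M) :
  (forall i, P i -> K (F i)) -> K (\sum_(i <- r | P i) F i).
Proof. by move=> KF; elim/big_ind: _ => //; [apply: submod0 | apply: submodD]. Qed.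

Lemma submod_conductor x : is_ideal [set b | K (act b x)].
Proof.
split=> [|a b|a b] /=; first by rewrite act0l; apply: submod0.
  by rewrite actDl; apply: submodD.
by rewrite actM; apply: submodZ.
Qed.

Lemma submod_local_to_global (k : nat) (a c : 'I_k -> B) x :
  \sum_(i < k) c i * a i = 1 ->
  (forall i, exists m, K (act (a i ^+ m) x)) -> K x.
Proof.
move=> ca1 Kax; rewrite -(act1 x).
exact: (local_to_global ca1 (submod_conductor x)).
Qed.

End OneSubmodule.

Definition submod_add (K L : set M) : set M :=
  [set s | exists x y, [/\ K x, L y & s = x + y]].

Lemma submod_add_submodule K L :
  is_submodule K -> is_submodule L -> is_submodule (submod_add K L).
Proof.
move=> Ks Ls; split.
- by exists 0, 0; rewrite addr0; split=> //; apply: submod0.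
- move=> _ _ [x1 [y1 [Kx1 Ly1 ->]]] [x2 [y2 [Kx2 Ly2 ->]]].
  by exists (x1 + x2), (y1 + y2); rewrite addrACA; split=> //; apply: submodD.
- move=> b _ [x [y [Kx Ly ->]]]; exists (act b x), (act b y); rewrite actDr.
  by split=> //; apply: submodZ.
Qed.

Fixpoint span (G : seq M) : set M :=
  if G is g :: G' then [set x | exists b y, span G' y /\ x = act b g + y]
  else [set 0].

Lemma span_submodule G : is_submodule (span G).
Proof.
elim: G => [|g G IHG] /=.
  by split=> [//|x y -> ->|b x ->]; rewrite ?addr0 ?act0r.
split=> [|_ _ [a [x [Gx ->]]] [b [y [Gy ->]]]|b _ [a [x [Gx ->]]]].
- by exists 0, 0; rewrite act0l addr0; split=> //; apply: submod0.
- by exists (a + b), (x + y); rewrite addrACA actDl; split=> //; apply: submodD.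
- by exists (b * a), (act b x); rewrite actM actDr; split=> //; apply: submodZ.
Qed.

Lemma mem_span G g : g \in G -> span G g.
Proof.
elim: G => //= h G IHG; rewrite inE => /predU1P[->|/IHG Gg].
  by exists 1, 0; rewrite act1 addr0; split=> //; case: (span_submodule G).
by exists 0, g; rewrite act0l add0r.
Qed.

Lemma span_min G K : is_submodule K -> {in G, forall g, K g} -> span G `<=` K.
Proof.
move=> Ks; elim: G => [|g G IHG] /= KG; first by move=> _ ->; apply: submod0.
move=> _ [b [y [Gy ->]]]; apply: submodD => //.
  by apply: submodZ => //; apply: KG; rewrite inE eqxx.
by apply: IHG Gy => h hG; apply: KG; rewrite inE hG orbT.
Qed.

(** No determinant is used: the relation of the first generator is solved for it, its coefficient 1
    - w b being invertible, and the result is substituted into the other relations. *)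
Lemma nakayama (w : B) (G : seq M) K :
  (forall b, exists u, u * (1 + w * b) = 1) -> is_submodule K ->
  {in G, forall g, exists2 s, span G s & K (g - act w s)} -> span G `<=` K.
Proof.
move=> wU Ks; elim: G => [|g G IHG] KG; first exact: span_min.
have Gs := span_submodule G.
have [_ [b [y [Gy ->]]] Kg] : exists2 s, span (g :: G) s & K (g - act w s).
  by apply: KG; rewrite inE eqxx.
have [u uP] := wU (- b).
have Kgu : K (g - act w (act u y)).
  rewrite -{1}(act1 g) -uP actM (actC w u) -actBr; apply: submodZ => //.
  by rewrite actDl act1 mulrN actNl -addrA -opprD actM -actDr.
have KG' : span G `<=` K.
  apply: IHG => h hG.
  have [_ [b' [y' [Gy' ->]]] Kh] : exists2 s, span (g :: G) s & K (h - act w s).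
    by apply: KG; rewrite inE hG orbT.
  exists (act b' (act w (act u y)) + y').
    by apply: submodD => //; do 3!apply: submodZ => //.
  apply: submod_trans Kh _ => //; rewrite -actBr; apply: submodZ => //.
  by rewrite opprD addrACA subrr addr0 -actBr; apply: submodZ.
apply: span_min => // h; rewrite inE => /predU1P[->|hG].
  apply: (submodD_cancel Ks Kgu); apply: (submodZ Ks); apply: KG'.
  exact: (submodZ Gs).
by apply: KG'; apply: mem_span.
Qed.

End Modules.

Lemma partition_powers (B : comPzRingType) (k : nat) (a c : 'I_k -> B)
    (m : 'I_k -> nat) :
  \sum_(i < k) c i * a i = 1 ->
  exists c' : 'I_k -> B, \sum_(i < k) c' i * a i ^+ m i = 1.
Proof.
move=> ca1; suff [c' ->] : exists c', 1 = \sum_(i < k) c' i * a i ^+ m i by exists c'.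
pose J := [set x | exists c' : 'I_k -> B, x = \sum_(i < k) c' i * a i ^+ m i].
apply: (local_to_global (J := J) ca1) => [|i].
  split=> [|_ _ [u ->] [v ->]|s _ [u ->]].
  - by exists (fun=> 0); rewrite big1 // => i _; rewrite mul0r.
  - exists (fun i => u i + v i); rewrite -big_split; apply: eq_bigr => i _ /=.
    by rewrite mulrDl.
  - exists (fun i => s * u i); rewrite mulr_sumr; apply: eq_bigr => i _.
    by rewrite mulrA.
exists (m i), (fun j => (j == i)%:R); rewrite (bigD1 i) //= eqxx mul1r.
by rewrite big1 ?addr0 // => j /negbTE ->; rewrite mul0r.
Qed.

Lemma uniform_exponent (T : finType) (Q : T -> nat -> Prop) :
  (forall p m m', (m <= m')%N -> Q p m -> Q p m') ->
  (forall p, exists m, Q p m) -> exists m, forall p, Q p m.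
Proof.
move=> Qmono /fin_all_exists[m mP]; exists (\max_p m p)%N => p.
by apply: Qmono (mP p); apply: leq_bigmax.
Qed.

Section LocalCoordinates.
Variables (B : comPzRingType) (M : zmodType) (act : B -> M -> M) (K : set M).
Hypotheses (actP : is_action act) (K_sub : is_submodule act K).

Section Cover.
Variables (k : nat) (f c : 'I_k -> B) (r : 'I_k -> nat).
Variable (e : forall i, 'I_(r i) -> M).
Hypothesis cf1 : \sum_(i < k) c i * f i = 1.
Hypothesis e_gen : forall i x, exists m (b : 'I_(r i) -> B),
  K (act (f i ^+ m) x - \sum_(s < r i) act (b s) (e s)).
Hypothesis e_free : forall i (b : 'I_(r i) -> B),
  K (\sum_(s < r i) act (b s) (e s)) -> exists m, forall s, f i ^+ m * b s = 0.

Local Notation T := {i : 'I_k & 'I_(r i)}.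
Let tg i (s : 'I_(r i)) : T := Tagged (fun i => 'I_(r i)) s.
Let E (p : T) : M := e (tagged p).
Let comb (b : T -> B) : M := \sum_p act (b p) (E p).

Let combD b b' : comb (fun p => b p + b' p) = comb b + comb b'.
Proof. by rewrite -big_split; apply: eq_bigr => p _; rewrite (actDl actP). Qed.

Let combZ a b : comb (fun p => a * b p) = act a (comb b).
Proof. by rewrite (act_sumr actP); apply: eq_bigr => p _; rewrite (actM actP). Qed.

Let comb_delta a p : comb (fun q => a * (q == p)%:R) = act a (E p).
Proof.
rewrite /comb (bigD1 p) //= eqxx mulr1 big1 ?addr0 // => q /negbTE ->.
by rewrite mulr0 (act0l actP).
Qed.

Let comb_sum (I : finType) (b : I -> T -> B) :
  comb (fun p => \sum_i b i p) = \sum_i comb (b i).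
Proof.
rewrite exchange_big; apply: eq_bigr => p _; exact: (act_suml actP).
Qed.

Let generated x : exists b, K (x - comb b).
Proof.
pose N := submod_add K (range comb).
have cs : is_submodule act (range comb).
  split=> [|_ _ [b _ <-] [b' _ <-]|a _ [b _ <-]].
  - exists (fun=> 0) => //; rewrite /comb big1 // => p _; exact: (act0l actP).
  - by exists (fun p => b p + b' p) => //; rewrite combD.
  - by exists (fun p => a * b p) => //; rewrite combZ.
suff [y [_ [Ky [b _ <-] ->]]] : N x by exists b; rewrite addrK.
have Ns : is_submodule act N := submod_add_submodule actP K_sub cs.
apply: (submod_local_to_global actP Ns cf1) => i.
have [m [b Kb]] := e_gen i x; exists m.
set u := \sum_(s < r i) _ in Kb; exists (act (f i ^+ m) x - u), u.
rewrite subrK; split=> //.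
apply: (submod_sum cs) => s _; exists (fun q => b s * (q == tg s)%:R) => //.
Qed.

Let exponents : exists (m : 'I_k -> nat) (b : forall i, T -> 'I_(r i) -> B),
  forall i p, K (act (f i ^+ m i) (E p) - \sum_(s < r i) act (b i p s) (e s)).
Proof.
have H i : exists m, exists b : T -> 'I_(r i) -> B, forall p,
    K (act (f i ^+ m) (E p) - \sum_(s < r i) act (b p s) (e s)).
  pose Q p m := exists b : 'I_(r i) -> B,
    K (act (f i ^+ m) (E p) - \sum_(s < r i) act (b s) (e s)).
  have [p m m' lemm' [b Kb]|p|m mP] := @uniform_exponent T Q.
  - exists (fun s => f i ^+ (m' - m) * b s).
    have -> : \sum_(s < r i) act (f i ^+ (m' - m) * b s) (e s) =
        act (f i ^+ (m' - m)) (\sum_(s < r i) act (b s) (e s)).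
      by rewrite (act_sumr actP); apply: eq_bigr => s _; rewrite (actM actP).
    rewrite -{1}(subnK lemm') exprD (actM actP) -(actBr actP).
    exact: (submodZ K_sub).
  - exact: e_gen.
  - by exists m; have [b bP] := fin_all_exists mP; exists b.
have [m mP] := fin_all_exists H.
have [b bP] := fin_all_exists mP.
by exists m, b.
Qed.

(* The relations between the generators e_(j, s) are generated by finitely    *)
(* many of them, the rho l p below, so one power of f i makes the coordinates *)
(* on D(f i) well defined on all of M.                                        *)
Lemma cover_coordinates i : exists m (psi : 'I_(r i) -> M -> B),
  [/\ forall s b x y, psi s (act b x + y) = b * psi s x + psi s y,
      forall s x, K x -> psi s x = 0 &
      forall x, K (act (f i ^+ m) x - \sum_(s < r i) act (psi s x) (e s))].
Proof.
have [m [b bP]] := exponents.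
pose lin j s (u : T -> B) := \sum_p u p * b j p s.
have linD j s u u' : lin j s (fun p => u p + u' p) = lin j s u + lin j s u'.
  by rewrite -big_split; apply: eq_bigr => p _; rewrite mulrDl.
have linZ j s a u : lin j s (fun p => a * u p) = a * lin j s u.
  by rewrite mulr_sumr; apply: eq_bigr => p _; rewrite mulrA.
have lin_delta j s a p : lin j s (fun q => a * (q == p)%:R) = a * b j p s.
  rewrite /lin (bigD1 p) //= eqxx mulr1 big1 ?addr0 // => q /negbTE ->.
  by rewrite mulr0 mul0r.
have lin_sum j s (I : finType) (u : I -> T -> B) :
    lin j s (fun p => \sum_i0 u i0 p) = \sum_i0 lin j s (u i0).
  by rewrite exchange_big; apply: eq_bigr => p _; rewrite mulr_suml.
have linP j u :
    K (act (f j ^+ m j) (comb u) - \sum_(s < r j) act (lin j s u) (e s)).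
  rewrite /comb (act_sumr actP).
  rewrite (eq_bigr (fun s => \sum_p act (u p) (act (b j p s) (e s)))); last first.
    by move=> s _; rewrite (act_suml actP); apply: eq_bigr => p _; rewrite (actM actP).
  rewrite exchange_big -sumrB; apply: (submod_sum K_sub) => p _.
  rewrite (actC actP) -(act_sumr actP) -(actBr actP); exact: (submodZ K_sub).
have rel_lin u : K (comb u) ->
    forall j, exists m', forall s, f j ^+ m' * lin j s u = 0.
  move=> Ku j; apply: e_free; have := linP j u => /(submodBC actP K_sub) H.
  by apply: (submodD_cancel K_sub H); apply: (submodZ K_sub).
pose rho l p q := f l ^+ m l * (q == p)%:R
  - \sum_(s < r l) b l p s * (q == tg s)%:R.
have combN u : comb (fun p => - u p) = - comb u.
  by rewrite -sumrN; apply: eq_bigr => p _; rewrite (actNl actP).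
have rho_rel l p : K (comb (rho l p)).
  rewrite /rho combD combN comb_sum comb_delta.
  by under [X in _ - X]eq_bigr do rewrite comb_delta.
have [Mi MiP] : exists Mi, forall lps : 'I_k * T * 'I_(r i),
    f i ^+ Mi * lin i lps.2 (rho lps.1.1 lps.1.2) = 0.
  apply: uniform_exponent => [lps n n' lenn' h|[[l p] s]].
    by rewrite -(subnK lenn') exprD -mulrA h mulr0.
  by have [n nP] := rel_lin _ (rho_rel l p) i; exists n.
have rel_lin0 u : K (comb u) -> forall s, f i ^+ Mi * lin i s u = 0.
  move=> Ku s; pose J := [set x : B | x * (f i ^+ Mi * lin i s u) = 0].
  have Ji : is_ideal J.
    split=> [|x y|a x]; rewrite /J /= ?mul0r // -?mulrA ?mulrDl.
      by move=> -> ->; rewrite addr0.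
    by move=> ->; rewrite mulr0.
  suff: J 1 by rewrite /J /= mul1r.
  apply: (local_to_global (J := J) cf1) => [//|l].
  have [n nP] := rel_lin _ Ku l; exists (n + m l)%N; rewrite /J /= exprD.
  (* After multiplication by f l ^+ m l, a relation u is a combination of the rho l p up to the
     terms [lin l s' u], and these are killed by a power of f l. *)
  have uE q : f l ^+ m l * u q = \sum_p u p * rho l p q
      + \sum_(s' < r l) lin l s' u * (q == tg s')%:R.
    rewrite /rho.
    under eq_bigr do rewrite mulrBr.
    rewrite sumrB (bigD1 q) //= eqxx mulr1 big1 ?addr0; last first.
      by move=> p /negbTE; rewrite eq_sym => ->; rewrite !mulr0.
    rewrite mulrC -[LHS]addr0 -addrA; congr (_ + _); apply/eqP.
    rewrite eq_sym addrC subr_eq0; apply/eqP; rewrite /lin.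
    under eq_bigr do rewrite mulr_suml.
    rewrite exchange_big; apply: eq_bigr => p _; rewrite mulr_sumr.
    by apply: eq_bigr => s' _; rewrite mulrA.
  have linE : f l ^+ m l * lin i s u = \sum_p u p * lin i s (rho l p)
      + \sum_(s' < r l) lin l s' u * b i (tg s') s.
    rewrite -linZ (_ : lin i s _ = lin i s (fun q => \sum_p u p * rho l p q
      + \sum_(s' < r l) lin l s' u * (q == tg s')%:R)); last first.
      by congr (lin i s _); apply/funext => q; apply: uE.
    rewrite linD !lin_sum; congr (_ + _); apply: eq_bigr => p _; first exact: linZ.
    exact: lin_delta.
  have -> : f l ^+ n * f l ^+ m l * (f i ^+ Mi * lin i s u)
      = f i ^+ Mi * f l ^+ n * (f l ^+ m l * lin i s u) by ring.
  rewrite linE mulrDr !mulr_sumr big1 ?add0r => [|p _]; last first.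
    have /= h := MiP (l, p, s).
    have -> : f i ^+ Mi * f l ^+ n * (u p * lin i s (rho l p))
      = f l ^+ n * u p * (f i ^+ Mi * lin i s (rho l p)) by ring.
    by rewrite h mulr0.
  apply: big1 => s' _.
  have -> : f i ^+ Mi * f l ^+ n * (lin l s' u * b i (tg s') s)
      = f i ^+ Mi * b i (tg s') s * (f l ^+ n * lin l s' u) by ring.
  by rewrite nP mulr0.
have [cx cxP] := choice generated.
exists (Mi + m i)%N, (fun s x => f i ^+ Mi * lin i s (cx x)); split.
- move=> s a x y; apply/eqP; rewrite -subr_eq0; apply/eqP.
  rewrite mulrCA -mulrDr -mulrBr -linZ -linD -mulN1r -linZ -linD.
  apply: rel_lin0; rewrite combD (combZ (-1)) combD combZ (actNl actP) (act1 actP).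
  apply: (submod_trans K_sub (y := act a x + y)).
    exact/(submodBC actP K_sub)/cxP.
  rewrite opprD addrACA; apply: (submodD K_sub) => //.
  by rewrite -(actBr actP); apply: (submodZ K_sub).
- move=> s x Kx; apply: rel_lin0.
  exact: (submodD_cancel K_sub (submodBC actP K_sub (cxP x)) Kx).
- move=> x; rewrite exprD (actM actP).
  under eq_bigr do rewrite (actM actP).
  rewrite -(act_sumr actP) -(actBr actP); apply: (submodZ K_sub).
  apply: (submod_trans K_sub (y := act (f i ^+ m i) (comb (cx x)))) => //.
  by rewrite -(actBr actP); apply: (submodZ K_sub).
Qed.

End Cover.

Lemma locally_free_coordinates (ranks : set nat) : locally_free act K ranks ->
  exists k (f c : 'I_k -> B), \sum_(i < k) c i * f i = 1 /\
  forall i, exists2 r, ranks r & exists m (e : 'I_r -> M) (psi : 'I_r -> M -> B),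
  [/\ forall s b x y, psi s (act b x + y) = b * psi s x + psi s y,
      forall s x, K x -> psi s x = 0,
      forall x, K (act (f i ^+ m) x - \sum_(s < r) act (psi s x) (e s)) &
      forall b : 'I_r -> B, K (\sum_(s < r) act (b s) (e s)) ->
        exists m', forall s, f i ^+ m' * b s = 0].
Proof.
case=> k [f [c [cf1 H]]]; exists k, f, c; split=> // i.
have H' l : exists n, ranks n /\ free_after_inverting act K (f l) n.
  by have [n] := H l; exists n.
have [r rP] := fin_all_exists H'.
exists (r i); first by case: (rP i).
have [e eP] := fin_all_exists (fun l => (rP l).2).
have [m [psi [psiL psiK psiP]]] :=
  cover_coordinates cf1 (fun l => (eP l).1) (fun l => (eP l).2) i.
by exists m, (e i), psi; split=> // b; case: (eP i) => _; apply.
Qed.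

(** The local coordinates are glued by a partition of unity into a dual basis, so M/K is projective;
    [component_unique] uses this to split off an ideal. *)
Lemma locally_free_dual_basis (ranks : set nat) : locally_free act K ranks ->
  exists (T : finType) (g : T -> M) (psi : T -> M -> B),
  [/\ forall t b x y, psi t (act b x + y) = b * psi t x + psi t y,
      forall t x, K x -> psi t x = 0 &
      forall x, K (x - \sum_t act (psi t x) (g t))].
Proof.
move=> /locally_free_coordinates[k [f [c [cf1 H]]]].
have [r _ rP] := fin_all_exists2 H.
have [m mP] := fin_all_exists rP.
have [e eP] := fin_all_exists mP.
have [psi psiP] := fin_all_exists eP.
have [c' c'1] := partition_powers m cf1.
exists {i : 'I_k & 'I_(r i)}, (fun p => e _ (tagged p)).
exists (fun p x => c' (tag p) * psi _ (tagged p) x); split.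
- move=> [i s] b x y /=; case: (psiP i) => -> _ _ _; ring.
- by move=> [i s] x Kx /=; case: (psiP i) => _ -> //; rewrite mulr0.
- move=> x; rewrite -{1}(act1 actP x) -c'1 (act_suml actP).
  have := @sig_big_dep _ 0 (+%R) _ (fun i => 'I_(r i)) xpredT (fun i => xpredT)
    (fun i s => act (c' i * psi i s x) (e i s)).
  move=> /= <-.
  rewrite -sumrB; apply: (submod_sum K_sub) => i _.
  rewrite (actM actP); under [X in _ - X]eq_bigr do rewrite (actM actP).
  rewrite -(act_sumr actP) -(actBr actP); apply: (submodZ K_sub).
  by case: (psiP i).
Qed.

End LocalCoordinates.

(** * The symmetric algebra of an invertible module *)

Definition nonzero_ring (B : comPzRingType) (B_nz : (1 : B) != 0) : comNzRingType :=
  HB.pack B (GRing.PzSemiRing_isNonZero.Build B B_nz).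

Lemma rmorphism_of_fun (R S : comPzRingType) (f : R -> S) :
  (forall x y, f (x - y) = f x - f y) -> f 1 = 1 ->
  (forall x y, f (x * y) = f x * f y) ->
  exists g : {rmorphism R -> S}, forall x, g x = f x.
Proof.
move=> fB f1 fM.
pose add_mixin := GRing.isZmodMorphism.Build R S f fB.
pose mul_mixin := GRing.isMonoidMorphism.Build R S f (conj f1 fM).
pose g : {rmorphism R -> S} := HB.pack f add_mixin mul_mixin.
by exists g.
Qed.

Lemma scalar_of_fun (B : comPzRingType) (L : lmodType B) (f : L -> B) :
  (forall b v w, f (b *: v + w) = b * f v + f w) ->
  exists g : {scalar L}, forall v, g v = f v.
Proof.
move=> f_lin; pose mixin := GRing.isLinear.Build B L B _ f f_lin.
by pose g : {scalar L} := HB.pack f mixin; exists g.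
Qed.

Section GradedHom.
Variables (B : comPzRingType) (V : line_bundle B).
Local Notation S := (lb_ring V).
Local Notation str := (lb_str V).
Local Notation coord := (@lb_coord B V).

(* G s m is the coefficient of x^m in the image of s under the morphism from  *)
(* Sym(L^{-1}) to T[x] which extends t and sends a linear form f to h f * x;  *)
(* spelling T[x] out this way allows T to be the zero ring.                   *)
Definition graded_hom (T : comPzRingType) (t : B -> T)
    (h : {scalar (lb_mod V)} -> T) (G : S -> nat -> T) : Prop :=
  [/\ forall s u m, G (s + u) m = G s m + G u m,
      forall s u m, G (s * u) m = \sum_(k < m.+1) G s k * G u (m - k)%N,
      forall b m, G (str b) m = t b *+ (m == 0%N),
      forall f m, G (coord f) m = h f *+ (m == 1%N) &
      forall s, exists K, forall m, (K <= m)%N -> G s m = 0].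

Section Fixed.
Variables (T : comPzRingType) (t : {rmorphism B -> T}).
Variables (h : {scalar (lb_mod V)} -> T).

Lemma zero_ring_eq : (1 : T) = 0 -> forall x y : T, x = y.
Proof. by move=> T0 x y; rewrite -(mul1r x) -(mul1r y) T0 !mul0r. Qed.

Lemma graded_homN G s m : graded_hom t h G -> G (- s) m = - G s m.
Proof.
case=> GD _ Gt _ _; apply: (addIr (G s m)).
by rewrite -GD !addNr -(rmorph0 str) Gt rmorph0 mul0rn.
Qed.

Section Nonzero.
Variable T_nz : (1 : T) != 0.
Let P : comPzRingType := {poly nonzero_ring T_nz}.

Lemma nonzero_coefC (b : T) m :
  ((b : nonzero_ring T_nz)%:P)`_m = b *+ (m == 0%N).
Proof. by rewrite coefC; case: m. Qed.

Lemma nonzero_coefCX (b : T) m :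
  ((b : nonzero_ring T_nz)%:P * 'X)`_m = b *+ (m == 1%N).
Proof. by rewrite coefMX coefC; case: m => [|[|m]]. Qed.

Lemma graded_hom_poly G : graded_hom t h G ->
  exists x : {rmorphism S -> P}, forall s m, (x s)`_m = G s m.
Proof.
move=> Gh; have [GD GM Gt Gc Gf] := Gh.
have [K KP] := choice Gf.
pose x s : {poly nonzero_ring T_nz} := \poly_(m < K s) (G s m : nonzero_ring T_nz).
have xE s m : (x s)`_m = G s m.
  by rewrite coef_poly; case: ltnP => // Km; rewrite KP.
have [||| y yP] := @rmorphism_of_fun S P x.
- move=> s u; apply/polyP => m; rewrite coefB !xE GD; congr (_ + _).
  exact: graded_homN.
- apply/polyP => m; rewrite coef1 xE -(rmorph1 str) Gt rmorph1.
  by case: m.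
- by move=> s u; apply/polyP => m; rewrite coefM !xE GM; apply: eq_bigr => k _; rewrite !xE.
by exists y => s m; rewrite yP xE.
Qed.

Lemma polyC_rmorphism : exists c : {rmorphism T -> P},
  forall b, c b = (b : nonzero_ring T_nz)%:P.
Proof.
apply: rmorphism_of_fun; first exact: (@polyCB (nonzero_ring T_nz)).
  exact: (@polyC1 (nonzero_ring T_nz)).
exact: (@polyCM (nonzero_ring T_nz)).
Qed.

Lemma poly_hom_linear (c : {rmorphism T -> P}) : 
  (forall b, c b = (b : nonzero_ring T_nz)%:P) -> linear_on_dual t h ->
  linear_on_dual (c \o t) (fun f => c (h f) * 'X : {poly nonzero_ring T_nz}).
Proof.
move=> cP h_lin b f g k fgk; rewrite (h_lin _ _ _ _ fgk) rmorphD rmorphM /=.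
by rewrite mulrDl mulrA.
Qed.
End Nonzero.

Lemma graded_hom_exists : linear_on_dual t h -> exists G, graded_hom t h G.
Proof.
move=> h_lin; have [T0|T_nz] := eqVneq (1 : T) 0.
  exists (fun _ _ => 0); split=> *; try exact: zero_ring_eq.
  by exists 0%N.
have [c cP] := polyC_rmorphism T_nz.
have [_ univ] := lb_sym V.
have [x [xt xh] _] := univ _ _ _ (poly_hom_linear cP h_lin).
exists (fun s m => (x s : {poly nonzero_ring T_nz})`_m); split.
- by move=> s u m; rewrite rmorphD; apply: (@coefD (nonzero_ring T_nz)).
- by move=> s u m; rewrite rmorphM; apply: (@coefM (nonzero_ring T_nz)).
- move=> b m; have -> : x (str b) = (t b : nonzero_ring T_nz)%:P.
    by rewrite xt; apply: cP.
  exact: nonzero_coefC.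
- move=> f m; have -> : x (coord f) = (h f : nonzero_ring T_nz)%:P * 'X.
    by rewrite xh cP.
  exact: nonzero_coefCX.
- move=> s; exists (size (x s : {poly nonzero_ring T_nz})) => m.
  exact: nth_default.
Qed.

Lemma graded_hom_unique G1 G2 : linear_on_dual t h ->
  graded_hom t h G1 -> graded_hom t h G2 -> forall s m, G1 s m = G2 s m.
Proof.
move=> h_lin G1h G2h s m; have [T0|T_nz] := eqVneq (1 : T) 0.
  exact: zero_ring_eq.
have [c cP] := polyC_rmorphism T_nz.
have [_ univ] := lb_sym V.
have [x _ x_uniq] := univ _ _ _ (poly_hom_linear cP h_lin).
have lift G : graded_hom t h G -> forall s m, G s m = (x s : {poly nonzero_ring T_nz})`_m.
  move=> Gh s' m'; have [y yP] := graded_hom_poly T_nz Gh.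
  rewrite -yP; congr ((_ : {poly nonzero_ring T_nz})`_ _).
  have [_ _ Gt Gc _] := Gh.
  apply: x_uniq => [b|f]; apply/polyP => n; rewrite yP ?Gt ?Gc /= cP.
    exact/esym/nonzero_coefC.
  exact/esym/nonzero_coefCX.
by rewrite (lift _ G1h) (lift _ G2h).
Qed.

Lemma graded_hom_scale G a : graded_hom t h G ->
  graded_hom t (fun f => a * h f) (fun s m => a ^+ m * G s m).
Proof.
case=> GD GM Gt Gc Gf; split.
- by move=> s u m; rewrite GD mulrDr.
- move=> s u m; rewrite GM mulr_sumr; apply: eq_bigr => k _.
  have /subnK {1}<- : (k <= m)%N by rewrite -ltnS.
  by rewrite exprD; ring.
- by move=> b [|m]; rewrite Gt ?mul1r ?mulr0.
- by move=> f [|[|m]]; rewrite Gc ?mulr0.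
- by move=> s; have [K KP] := Gf s; exists K => m /KP ->; rewrite mulr0.
Qed.

Lemma linear_scale a : linear_on_dual t h -> linear_on_dual t (fun f => a * h f).
Proof. by move=> h_lin b f g k fgk; rewrite (h_lin _ _ _ _ fgk) mulrDr mulrCA. Qed.

End Fixed.

Lemma graded_hom_comp (T T' : comPzRingType) (t : B -> T) (th : {rmorphism T -> T'})
    h G : graded_hom t h G ->
  graded_hom (th \o t) (fun f => th (h f)) (fun s m => th (G s m)).
Proof.
case=> GD GM Gt Gc Gf; split.
- by move=> s u m; rewrite GD rmorphD.
- by move=> s u m; rewrite GM rmorph_sum; apply: eq_bigr => k _; rewrite rmorphM.
- by move=> b m; rewrite Gt rmorphMn.
- by move=> f m; rewrite Gc rmorphMn.
- by move=> s; have [K KP] := Gf s; exists K => m /KP ->; rewrite rmorph0.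
Qed.

Lemma coord_linear : linear_on_dual str coord.
Proof. by case: (lb_sym V). Qed.

(** Setting x = 1 in the morphism S -> S[x], f |-> f x, gives an endomorphism that fixes scalars and
    linear forms, hence the identity. So s is the sum of its homogeneous components. *)
Lemma graded_hom_id_sum G : graded_hom str coord G ->
  forall s K, (forall m, (K <= m)%N -> G s m = 0) -> s = \sum_(m < K) G s m.
Proof.
move=> Gh s K KP; have [S0|S_nz] := eqVneq (1 : S) 0.
  exact: zero_ring_eq.
have [x xP] := graded_hom_poly S_nz Gh.
have [||| y yP] := @rmorphism_of_fun S S
    (fun s => (x s : {poly nonzero_ring S_nz}).[1]).
- move=> a b; have hornerB (p q : {poly nonzero_ring S_nz}) : (p - q).[1] = p.[1] - q.[1].
    by rewrite hornerD hornerN.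
  by rewrite rmorphB; apply: hornerB.
- rewrite rmorph1; exact: (@hornerC (nonzero_ring S_nz)).
- move=> a b; rewrite rmorphM; exact: (@hornerM (nonzero_ring S_nz)).
have [lin univ] := lb_sym V; have [_ _ Gt Gc _] := Gh.
have [z _ z_uniq] := univ _ _ _ lin.
have sE : s = y s.
  have -> : y s = z s.
    apply: z_uniq => [b|f]; rewrite yP.
      have -> : x (str b) = (str b : nonzero_ring S_nz)%:P.
        by apply/polyP => m; rewrite xP Gt; apply/esym/nonzero_coefC.
      exact: (@hornerC (nonzero_ring S_nz)).
    have -> : x (coord f) = (coord f : nonzero_ring S_nz)%:P * 'X.
      by apply/polyP => m; rewrite xP Gc; apply/esym/nonzero_coefCX.
    rewrite hornerMX hornerC; exact: (@mulr1 (nonzero_ring S_nz)).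
  exact: (z_uniq idfun).
rewrite {1}sE yP (@horner_coef_wide _ K); last first.
  by apply/leq_sizeP => m /KP; rewrite -xP.
by apply: eq_bigr => m _; rewrite expr1n xP; apply: (@mulr1 (nonzero_ring S_nz)).
Qed.

End GradedHom.

Section Coefficients.
Variables (B : comPzRingType) (V : line_bundle B).
Local Notation S := (lb_ring V).
Local Notation str := (lb_str V).
Local Notation coord := (@lb_coord B V).
Implicit Types (s t : S) (v : lb_mod V) (f : {scalar (lb_mod V)}).

Lemma value_linear v :
  @linear_on_dual B (lb_mod V) B idfun (fun f : {scalar (lb_mod V)} => f v).
Proof. by move=> b f g k fgk; apply: fgk. Qed.

(* [chi v s m] is the coefficient of x^m in the restriction of s to the       *)
(* parametrised line x |-> x v.                                               *)
Definition chi v : S -> nat -> B :=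
  sval (cid (graded_hom_exists (t := idfun) (@value_linear v))).

Lemma chiP v :
  graded_hom (idfun : B -> B) (fun f : {scalar (lb_mod V)} => f v) (chi v).
Proof. by rewrite /chi; case: cid. Qed.

Lemma chiD v s t m : chi v (s + t) m = chi v s m + chi v t m.
Proof. by case: (chiP v). Qed.

Lemma chiM v s t m :
  chi v (s * t) m = \sum_(k < m.+1) chi v s k * chi v t (m - k)%N.
Proof. by case: (chiP v). Qed.

Lemma chi_str v b m : chi v (str b) m = b *+ (m == 0%N).
Proof. by case: (chiP v) => _ _ ->. Qed.

Lemma chi_coord v f m : chi v (coord f) m = f v *+ (m == 1%N).
Proof. by case: (chiP v) => _ _ _ ->. Qed.

Lemma chi_finite v s : exists K, forall m, (K <= m)%N -> chi v s m = 0.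
Proof. by case: (chiP v). Qed.

Lemma chiN v s m : chi v (- s) m = - chi v s m.
Proof. exact: (@graded_homN B V B idfun _ (chi v) s m (chiP v)). Qed.

Lemma chiB v s t m : chi v (s - t) m = chi v s m - chi v t m.
Proof. by rewrite chiD chiN. Qed.

Lemma chi0 v m : chi v 0 m = 0.
Proof. by rewrite -(subrr 0) chiB subrr. Qed.

Lemma chi_sum v m (I : Type) (r : seq I) P (F : I -> S) :
  chi v (\sum_(i <- r | P i) F i) m = \sum_(i <- r | P i) chi v (F i) m.
Proof. by apply: (big_morph (chi v ^~ m)) => [s t|]; rewrite ?chiD ?chi0. Qed.

Lemma chi1 v m : chi v 1 m = 1 *+ (m == 0%N).
Proof. by rewrite -(rmorph1 str) chi_str. Qed.

Lemma chiZ v b s m : chi v (str b * s) m = b * chi v s m.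
Proof.
rewrite chiM (bigD1 ord0) //= chi_str subn0 big1 ?addr0 // => k /negbTE k0.
by rewrite chi_str -(inj_eq val_inj) /= in k0 *; rewrite k0 mul0r.
Qed.

Lemma chi_mul_homog v s t n m : (forall k, k != n -> chi v t k = 0) ->
  chi v (s * t) (m + n)%N = chi v s m * chi v t n.
Proof.
move=> t_n; have le_m : (m < (m + n).+1)%N by rewrite ltnS leq_addr.
rewrite chiM (bigD1 (Ordinal le_m)) //= addKn big1 ?addr0 // => k.
rewrite -(inj_eq val_inj) /= => km; rewrite t_n ?mulr0 //.
by apply: contraNneq km => kn; have := ltn_ord k; lia.
Qed.

Lemma chi_mul_homog0 v s t n m : (forall k, k != n -> chi v t k = 0) ->
  (forall k, (k + n)%N = m -> chi v s k = 0) -> chi v (s * t) m = 0.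
Proof.
move=> t_n s_k; rewrite chiM big1 // => k _.
have [mk|mk] := eqVneq (m - k)%N n; last by rewrite t_n ?mulr0.
by rewrite s_k ?mul0r //; have := ltn_ord k; lia.
Qed.

Lemma chi_monomial v f n m : chi v (coord f ^+ n) m = f v ^+ n *+ (m == n).
Proof.
have f_homog k : k != 1%N -> chi v (coord f) k = 0.
  by move=> /negbTE k1; rewrite chi_coord k1.
elim: n m => [|n IHn] m; first by rewrite !expr0 chi1.
have [->|mn] := eqVneq m n.+1.
  rewrite exprSr -[X in chi v _ X]addn1 (chi_mul_homog _ _ f_homog) IHn.
  by rewrite chi_coord !eqxx exprSr.
rewrite exprSr (chi_mul_homog0 f_homog) // => k km.
by rewrite IHn; case: eqP => // kn; case/eqP: mn; rewrite -km kn addn1.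
Qed.

Lemma chi_scale a b (u v : lb_mod V) s m : a *: u = b *: v ->
  a ^+ m * chi u s m = b ^+ m * chi v s m.
Proof.
move=> auv; have lin w c := @linear_scale B V B idfun _ c (@value_linear w).
have H w c := @graded_hom_scale B V B idfun _ (chi w) c (chiP w).
have Hv := H v b.
have hE : (fun f : {scalar (lb_mod V)} => b * f v) = (fun f => a * f u).
  by apply/funext => f; rewrite -!(linearZ_LR f) auv.
rewrite hE in Hv; exact: (graded_hom_unique (lin u a) (H u a) Hv s m).
Qed.

Lemma coordZ b f (g : {scalar (lb_mod V)}) : (forall v, g v = b * f v) -> coord g = str b * coord f.
Proof.
have coordD := @coord_linear B V.
have [z zP] : exists z : {scalar (lb_mod V)}, forall v, z v = 0.
  by apply: scalar_of_fun => c v w; rewrite mulr0 addr0.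
have z0 : coord z = 0.
  apply: (addrI (coord z)); rewrite addr0 -{1}(mul1r (coord z)) -{1}(rmorph1 str).
  by rewrite -(coordD 1 z z z) // => v; rewrite zP mulr0 addr0.
by move=> gE; rewrite (coordD b f z g) ?z0 ?addr0 // => v; rewrite gE zP addr0.
Qed.

Lemma coord_exists b f : exists g : {scalar (lb_mod V)},
  (forall v, g v = b * f v) /\ coord g = str b * coord f.
Proof.
have [g gE] : exists g : {scalar (lb_mod V)}, forall v, g v = b * f v.
  by apply: scalar_of_fun => c v w; rewrite linearP mulrDr mulrCA.
by exists g; split=> //; apply: coordZ.
Qed.

End Coefficients.

(* ch_form i (ch_vec i) is the a with L trivialised by ch_vec i on D(a).      *)
Record charts (k : nat) (B : comPzRingType) (V : line_bundle B) := Charts {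
  ch_weight : 'I_k -> B;
  ch_vec : 'I_k -> lb_mod V;
  ch_form : 'I_k -> {scalar (lb_mod V)};
  ch_sum1 : \sum_(i < k) ch_weight i * ch_form i (ch_vec i) = 1;
  ch_line : forall i v, ch_form i v *: ch_vec i = ch_form i (ch_vec i) *: v
}.

Lemma charts_exist (B : comPzRingType) (V : line_bundle B)  :
  exists k, inhabited (charts k V).
Proof.
pose L := lb_mod V; pose act (b : B) (v : L) := b *: v.
have actP : is_action act.
  split=> [x|a b x|a x y|a b x]; rewrite /act ?scale1r ?scalerA //.
    exact: scalerDr.
  exact: scalerDl.
have K_sub : is_submodule act [set 0].
  by split=> [//|x y -> ->|b x ->]; rewrite ?addr0 /act ?scaler0.
have [k [f [c [cf1 H]]]] := locally_free_coordinates actP K_sub (lb_invertible V).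
have local i : exists m, exists el : L * {scalar L},
    el.2 el.1 = f i ^+ m /\ forall v, el.2 v *: el.1 = f i ^+ m *: v.
  have [_ -> [m [e [psi [psiL _ psiP e_free]]]]] := H i.
  have psiE v : psi ord0 v *: e ord0 = f i ^+ m *: v.
    by apply/eqP; rewrite eq_sym -subr_eq0; apply/eqP; have := psiP v; rewrite big_ord1.
  (* The coordinate of the basis vector itself is f i ^+ m only up to a power of f i; that power is
     absorbed into the linear form l. *)
  have [|m' m'P] := e_free (fun=> psi ord0 (e ord0) - f i ^+ m).
    by rewrite big_ord1 /act scalerBl psiE subrr.
  have [l lE] : exists l : {scalar L}, forall v, l v = f i ^+ m' * psi ord0 v.
    by apply: scalar_of_fun => b v w; rewrite psiL; ring.
  exists (m' + m)%N, (e ord0, l) => /=; split=> [|v]; rewrite lE exprD.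
    by apply/eqP; rewrite -subr_eq0 -mulrBr (m'P ord0).
  by rewrite -!scalerA; congr (_ *: _); apply: psiE.
have [m mP] := fin_all_exists local.
have [el elP] := fin_all_exists mP.
have [c' c'1] := partition_powers m cf1.
exists k; apply: (inhabits (@Charts k B V c' (fun i => (el i).1) (fun i => (el i).2) _ _)).
  by rewrite -[RHS]c'1; apply: eq_bigr => i _; rewrite (elP i).1.
by move=> i v; rewrite (elP i).1 (elP i).2.
Qed.

Section Charts.
Variables (B : comPzRingType) (V : line_bundle B) (sz : nat) (ch : charts sz V).
Local Notation S := (lb_ring V).
Local Notation str := (lb_str V).
Local Notation coord := (@lb_coord B V).
Local Notation I := 'I_sz.
Local Notation e := (ch_vec ch).
Local Notation l := (ch_form ch).
Implicit Types (s t : S) (f : {scalar (lb_mod V)}) (i j : I).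

Definition chX i : S := coord (l i).
Definition chA i : B := l i (e i).
Local Notation X := chX.
Local Notation a := chA.

Lemma weights_exist m : exists c : I -> B, \sum_(i : I) c i * a i ^+ m = 1.
Proof. exact: (partition_powers (fun=> m) (ch_sum1 ch)). Qed.

Definition weight m : I -> B := sval (cid (weights_exist m)).

Lemma weight_sum1 m : \sum_(i : I) weight m i * a i ^+ m = 1.
Proof. by rewrite /weight; case: cid. Qed.

Lemma coord_chart i f : str (a i) * coord f = str (f (e i)) * X i.
Proof.
have [g [gE <-]] := coord_exists (a i) f.
rewrite /chX -(coordZ (g := g)) // => v; rewrite gE.
have := congr1 f (ch_line ch i v); rewrite !(linearZ_LR f) /= => <-.
by rewrite mulrC.
Qed.

Lemma monomial_chart i j m :
  str (a i ^+ m) * X j ^+ m = str (l j (e i) ^+ m) * X i ^+ m.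
Proof. by rewrite !rmorphXn /= -!exprMn coord_chart. Qed.

Lemma chi_chart i j s m :
  a i ^+ m * chi (e j) s m = l i (e j) ^+ m * chi (e i) s m.
Proof. by apply: chi_scale; rewrite ch_line. Qed.

Lemma chart_local_to_global (J : set B) : is_ideal J ->
  (forall i, exists m, J (a i ^+ m)) -> J 1.
Proof. exact: (local_to_global (ch_sum1 ch)). Qed.

Definition deg_lt (D : nat) s := forall i m, (D <= m)%N -> chi (e i) s m = 0.
Definition homog (n : nat) s := forall i m, m != n -> chi (e i) s m = 0.

Lemma deg_lt_exists s : exists K, deg_lt K s.
Proof.
have [K KP] := fin_all_exists (fun i => chi_finite (e i) s).
exists (\max_i K i)%N => i m Km; apply: KP; apply: leq_trans Km.
exact: leq_bigmax.
Qed.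

(** On D(a i) the degree m component of s is chi (e i) s m X_i^m / a_i^m. The weights, with sum of
    c_i a_i^m equal to 1, glue these local formulas. *)
Lemma expansion s K : deg_lt K s ->
  s = \sum_(m < K) \sum_(i : I) str (weight m i * chi (e i) s m) * X i ^+ m.
Proof.
move=> sK; have coord_lin := @coord_linear B V.
have [Psi PsiP] := graded_hom_exists coord_lin.
have component i m : str (a i) ^+ m * Psi s m = X i ^+ m * str (chi (e i) s m).
  have H := graded_hom_scale (str (a i)) PsiP.
  have H' := graded_hom_scale (t := str) (X i) (graded_hom_comp str (chiP (e i))).
  have hE : (fun f : {scalar (lb_mod V)} => X i * str (f (e i)))
      = (fun f => str (a i) * coord f).
    by apply/funext => f; rewrite coord_chart mulrC.
  rewrite hE in H'.
  exact: (graded_hom_unique (linear_scale (str (a i)) coord_lin) H H' s m).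
have PsiE m : Psi s m
    = \sum_(i : I) str (weight m i * chi (e i) s m) * X i ^+ m.
  rewrite -{1}(mul1r (Psi s m)) -(rmorph1 str) -(weight_sum1 m) rmorph_sum mulr_suml.
  apply: eq_bigr => i _; rewrite !rmorphM rmorphXn -mulrA component.
  by rewrite mulrA mulrAC.
rewrite [LHS](graded_hom_id_sum PsiP (K := K)) => [|m Km].
  by apply: eq_bigr => m _; rewrite PsiE.
by rewrite PsiE big1 // => i _; rewrite sK // mulr0 rmorph0 mul0r.
Qed.

Lemma chi_eq0 s : (forall i m, chi (e i) s m = 0) -> s = 0.
Proof.
move=> s0; rewrite [s](@expansion s 0) ?big_ord0 //.
Qed.

Lemma chi_inj s t : (forall i m, chi (e i) s m = chi (e i) t m) -> s = t.
Proof.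
move=> st; apply/eqP; rewrite -subr_eq0; apply/eqP/chi_eq0 => i m.
by rewrite chiB st subrr.
Qed.

Lemma homog_expansion s n : homog n s ->
  s = \sum_(i : I) str (weight n i * chi (e i) s n) * X i ^+ n.
Proof.
move=> sn; rewrite [LHS](@expansion s n.+1) => [|i m nm]; last first.
  by apply: sn; rewrite gtn_eqF.
rewrite big_ord_recr /= big1 ?add0r // => m _; rewrite big1 // => i _.
by rewrite sn ?mulr0 ?rmorph0 ?mul0r // ltn_eqF.
Qed.

Lemma homog_chart i s n : homog n s ->
  str (a i ^+ n) * s = str (chi (e i) s n) * X i ^+ n.
Proof.
move=> sn; apply: chi_inj => j m; rewrite !chiZ chi_monomial.
have [->|mn] := eqVneq m n; last by rewrite sn // !mulr0.
by rewrite chi_chart mulrC.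
Qed.

Lemma homog0 n : homog n 0. Proof. by move=> i m _; rewrite chi0. Qed.

Lemma homogD n s t : homog n s -> homog n t -> homog n (s + t).
Proof. by move=> sn tn i m mn; rewrite chiD sn ?tn ?addr0. Qed.

Lemma homogZ n b s : homog n s -> homog n (str b * s).
Proof. by move=> sn i m mn; rewrite chiZ sn ?mulr0. Qed.

Lemma homog_sum n (J : Type) (r : seq J) (P : pred J) (F : J -> S) :
  (forall k, P k -> homog n (F k)) -> homog n (\sum_(k <- r | P k) F k).
Proof. by move=> Fn; elim/big_ind: _ => //; [apply: homog0 | apply: homogD]. Qed.

Lemma homogM m n s t : homog m s -> homog n t -> homog (m + n) (s * t).
Proof.
move=> sm tn i k kmn; apply: (chi_mul_homog0 (tn i)) => k' k'E.
by apply: sm; apply: contraNneq kmn => <-; rewrite k'E.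
Qed.

Lemma homog_coord f : homog 1 (coord f).
Proof. by move=> i m /negbTE m1; rewrite chi_coord m1. Qed.

Lemma homog_monomial f n : homog n (coord f ^+ n).
Proof. by move=> i m /negbTE mn; rewrite chi_monomial mn. Qed.

Lemma homog1 : homog 0 1.
Proof. by move=> i m /negbTE m0; rewrite chi1 m0. Qed.

Lemma homogX n k s : homog n s -> homog (n * k) (s ^+ k).
Proof.
move=> sn; elim: k => [|k IHk]; first by rewrite expr0 muln0; apply: homog1.
by rewrite exprS mulnS; apply: homogM.
Qed.

Lemma sym_degree_homog m s : sym_degree m s -> homog m s.
Proof.
case=> k [b [f ->]]; apply: homog_sum => i _; apply: homogZ.
move: (f i) => {}f {b k i s}; elim: m f => [|m IHm] f.
  by rewrite big_ord0; apply: homog1.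
by rewrite big_ord_recl; apply: (@homogM 1 m _ _ (homog_coord _) (IHm _)).
Qed.

Lemma homog_deg_lt n D s : (n < D)%N -> homog n s -> deg_lt D s.
Proof. by move=> nD sn i m Dm; apply: sn; rewrite gtn_eqF // (leq_trans nD). Qed.

Lemma deg_ltS D D' s : (D <= D')%N -> deg_lt D s -> deg_lt D' s.
Proof. by move=> DD' sD i m D'm; apply: sD; apply: leq_trans D'm. Qed.

Lemma deg_lt0 D : deg_lt D 0. Proof. by move=> i m _; rewrite chi0. Qed.

Lemma deg_ltD D s t : deg_lt D s -> deg_lt D t -> deg_lt D (s + t).
Proof. by move=> sD tD i m Dm; rewrite chiD sD ?tD ?addr0. Qed.

Lemma deg_ltN D s : deg_lt D s -> deg_lt D (- s).
Proof. by move=> sD i m Dm; rewrite chiN sD ?oppr0. Qed.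

Lemma deg_ltZ D b s : deg_lt D s -> deg_lt D (str b * s).
Proof. by move=> sD i m Dm; rewrite chiZ sD ?mulr0. Qed.

Lemma deg_lt_sum D (J : Type) (r : seq J) (P : pred J) (F : J -> S) :
  (forall k, P k -> deg_lt D (F k)) -> deg_lt D (\sum_(k <- r | P k) F k).
Proof. by move=> FD; elim/big_ind: _ => //; [apply: deg_lt0 | apply: deg_ltD]. Qed.

Lemma deg_ltM D D' s t : deg_lt D.+1 s -> deg_lt D' t -> deg_lt (D + D') (s * t).
Proof.
move=> sD tD i m Dm; rewrite chiM big1 // => k _.
have [kD|kD] := ltnP k D.+1; last by rewrite sD ?mul0r.
by rewrite tD ?mulr0 //; have := ltn_ord k; lia.
Qed.

Lemma span_monomials (K : set S) : is_submodule (fun b s => str b * s) K ->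
  forall D s, deg_lt D s ->
  (forall i m, (m < D)%N -> K (X i ^+ m)) -> K s.
Proof.
move=> K_sub D s sD KX; rewrite (expansion sD).
by do 2![apply: (submod_sum K_sub) => ? _]; apply/(submodZ K_sub)/KX.
Qed.

Lemma homog_span (K : set S) : is_submodule (fun b s => str b * s) K ->
  forall n s, homog n s -> (forall i, K (X i ^+ n)) -> K s.
Proof.
move=> K_sub n s sn KX; rewrite (homog_expansion sn).
by apply: (submod_sum K_sub) => i _; apply/(submodZ K_sub)/KX.
Qed.

(** Let P be a prime and a_i outside P. From a_i^n s = chi (e i) s n X_i^n and the nonvanishing of s
    at P, the coefficient chi (e i) s n is outside P, so near P both X_i^n and X_j^n are multiples
    of s. *)
Lemma nowhere_vanishing_generates n s : homog n s -> nowhere_vanishing s ->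
  forall j, exists b, X j ^+ n = str b * s.
Proof.
move=> sn s_nv j; pose J := [set b | exists b', str b * X j ^+ n = str b' * s].
have Ji : is_ideal J.
  split=> [|b1 b2 [c1 e1] [c2 e2]|b1 b2 [c2 e2]].
  - by exists 0; rewrite rmorph0 !mul0r.
  - by exists (c1 + c2); rewrite !rmorphD !mulrDl e1 e2.
  - by exists (b1 * c2); rewrite !rmorphM -!mulrA e2.
suff [b'] : J 1 by rewrite rmorph1 mul1r => ->; exists b'.
apply: contrapT => J1; have [P Pp JP] := exists_prime_ideal Ji J1.
have [Pi P1 PM] := Pp.
have [i aP] : exists i, ~ P (a i).
  apply: contrapT => /forallNP aP; apply: P1; rewrite -(ch_sum1 ch).
  apply: (ideal_sum Pi) => i _; apply: (idealMl Pi); by apply: contrapT; apply: aP.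
have aXP : ~ P (a i ^+ n) by move=> /(prime_idealX Pp).
have chiPn : ~ P (chi (e i) s n).
  move=> Pchi; apply: (s_nv P Pp); exists (a i ^+ n) => //.
  rewrite (homog_chart i sn); apply: (idealMr (ideal_gen_ideal _)).
  by apply: sub_ideal_gen; exists (chi (e i) s n).
have /JP/PM[] // : J (chi (e i) s n * a i ^+ n).
exists (l j (e i) ^+ n * a i ^+ n).
rewrite [in RHS]rmorphM -mulrA (homog_chart i sn) rmorphM -mulrA monomial_chart.
ring.
Qed.

(** If u s had all its coefficients in P, so would u X_j^n, whose coefficient along e_j is u a_j^n;
    then P would contain every a_j. *)
Lemma generates_nowhere_vanishing n s :
  (forall j, exists b, X j ^+ n = str b * s) -> nowhere_vanishing s.
Proof.
move=> sX P Pp [u uP us]; have [Pi P1 PM] := Pp.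
pose J := [set t | forall i m, P (chi (e i) t m)].
have Ji : is_ideal J.
  split=> [i m|t1 t2 h1 h2 i m|t1 t2 h2 i m].
  - by rewrite chi0; apply: (ideal0 Pi).
  - by rewrite chiD; apply: (idealD Pi).
  - by rewrite chiM; apply: (ideal_sum Pi) => k _; apply: (idealMl Pi).
have PJ : [set str b | b in P] `<=` J.
  move=> _ [b Pb <-] i m; rewrite chi_str; case: (m == 0%N) => //.
  exact: (ideal0 Pi).
have Jus := ideal_gen_min Ji PJ us.
apply: P1; rewrite -(ch_sum1 ch); apply: (ideal_sum Pi) => j _.
apply: (idealMl Pi); have [b bX] := sX j.
have : J (str b * (str u * s)) by exact: (idealMl Ji _ Jus).
rewrite mulrCA -bX => /(_ j n); rewrite chiZ chi_monomial eqxx mulr1n.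
by move=> /PM[//|]; apply: prime_idealX.
Qed.

End Charts.

(** * Base change of line bundles and charts *)

Section BaseChange.
Variables (B B' : comPzRingType) (phi : {rmorphism B -> B'}).
Variables (V : line_bundle B) (V' : line_bundle B').

Definition line_bundle_base_change (lam : lb_mod V -> lb_mod V')
    (g : {rmorphism lb_ring V -> lb_ring V'}) : Prop :=
  let semilinear (M : lmodType B') (h : lb_mod V -> M) :=
    forall b v w, h (b *: v + w) = phi b *: h v + h w in
  [/\ semilinear _ lam,
      forall (M : lmodType B') (h : lb_mod V -> M), semilinear M h ->
        exists2 h' : {linear lb_mod V' -> M}, (forall v, h' (lam v) = h v) &
          forall k : {linear lb_mod V' -> M},
            (forall v, k (lam v) = h v) -> k =1 h',
      forall b, g (lb_str V b) = lb_str V' (phi b) &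
      forall (f : {scalar (lb_mod V)}) (f' : {scalar (lb_mod V')}),
        (forall v, f' (lam v) = phi (f v)) -> g (lb_coord f) = lb_coord f'].

Variables (lam : lb_mod V -> lb_mod V').
Variables (g : {rmorphism lb_ring V -> lb_ring V'}).
Hypothesis bc : line_bundle_base_change lam g.

Lemma bc_str b : g (lb_str V b) = lb_str V' (phi b).
Proof. by case: bc. Qed.

Lemma lamZ b v : lam (b *: v) = phi b *: lam v.
Proof.
case: bc => lamP _ _ _; have lam0 : lam 0 = 0.
  by apply: (addrI (lam 0)); rewrite -{1}(scale1r (lam 0)) -(rmorph1 phi) -lamP scale1r !addr0.
by rewrite -[b *: v]addr0 lamP lam0 addr0.
Qed.

Lemma lamD v w : lam (v + w) = lam v + lam w.
Proof. by case: bc => lamP _ _ _; rewrite -[v]scale1r lamP rmorph1 !scale1r. Qed.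

Lemma extend_form (f : {scalar (lb_mod V)}) : exists f' : {scalar (lb_mod V')},
  (forall v, f' (lam v) = phi (f v)) /\ g (lb_coord f) = lb_coord f'.
Proof.
have [_ univ _ g_coord] := bc.
have [b v w|h' h'P _] := univ B'^o (fun v => phi (f v)).
  by rewrite linearP rmorphD rmorphM.
have [f' f'E] : exists f' : {scalar (lb_mod V')}, forall v, f' v = h' v.
  by apply: scalar_of_fun => b v w; rewrite linearP.
have f'P v : f' (lam v) = phi (f v) by rewrite f'E h'P.
by exists f'; split=> //; apply: g_coord.
Qed.

Lemma chi_base_change v s m : chi (lam v) (g s) m = phi (chi v s m).
Proof.
pose h := fun f : {scalar (lb_mod V)} => phi (f v).
have h_lin : linear_on_dual phi h.
  by move=> b f f1 k kE; rewrite /h kE rmorphD rmorphM.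
have G1 : graded_hom phi h (fun s m => phi (chi v s m)).
  exact: (graded_hom_comp phi (chiP v)).
apply/esym; apply: (graded_hom_unique h_lin G1 (G2 := fun s m => chi (lam v) (g s) m)).
split=> [s1 s2 k|s1 s2 k|b k|f k|s1].
- by rewrite rmorphD chiD.
- by rewrite rmorphM chiM.
- by rewrite bc_str chi_str.
- by have [f' [f'P ->]] := extend_form f; rewrite chi_coord f'P.
- exact: chi_finite.
Qed.

Lemma charts_base_change (k : nat) (ch : charts k V) :
  exists ch' : charts k V',
    [/\ forall i, ch_vec ch' i = lam (ch_vec ch i),
        forall i, chX ch' i = g (chX ch i) &
        forall i, chA ch' i = phi (chA ch i)].
Proof.
have [l' l'P] := fin_all_exists (fun i => extend_form (ch_form ch i)).
have sum1 : \sum_(i < k) phi (ch_weight ch i) * l' i (lam (ch_vec ch i)) = 1.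
  rewrite -(rmorph1 phi) -(ch_sum1 ch) rmorph_sum; apply: eq_bigr => i _.
  by rewrite (l'P i).1 rmorphM.
(* Both sides are linear in v' and agree on the image of [lam], so the uniqueness in the universal
   property identifies them. *)
have line i v' : l' i v' *: lam (ch_vec ch i) = l' i (lam (ch_vec ch i)) *: v'.
  have [_ univ _ _] := bc.
  pose h v := phi (chA ch i) *: lam v.
  have [b v w|h' _ h'_uniq] := univ (lb_mod V') h.
    by rewrite /h lamD lamZ scalerDr !scalerA mulrC.
  pose k1 v' := l' i v' *: lam (ch_vec ch i).
  have k1_lin : linear k1.
    by move=> b v w; rewrite /k1 linearP scalerDl scalerA.
  pose k2 v' := l' i (lam (ch_vec ch i)) *: v' : lb_mod V'.
  have k2_lin : linear k2.
    by move=> b v w; rewrite /k2 scalerDr !scalerA mulrC.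
  pose m1 := GRing.isLinear.Build _ _ _ _ k1 k1_lin.
  pose m2 := GRing.isLinear.Build _ _ _ _ k2 k2_lin.
  pose k1' : {linear lb_mod V' -> lb_mod V'} := HB.pack k1 m1.
  pose k2' : {linear lb_mod V' -> lb_mod V'} := HB.pack k2 m2.
  have -> : l' i v' *: lam (ch_vec ch i) = k1' v' by [].
  rewrite (h'_uniq k1') => [|v /=].
    rewrite -(h'_uniq k2') // => v /=.
    by rewrite /k2 (l'P i).1.
  by rewrite /k1 (l'P i).1 -lamZ ch_line lamZ.
exists (Charts sum1 line); split=> // i; first exact/esym/(l'P i).2.
by rewrite /chA /= (l'P i).1.
Qed.

End BaseChange.

(** * Finite fields *)

Section FiniteFieldAlgebras.
Variable F : finFieldType.
Local Notation q := #|F|.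

Lemma card_field_gt0 i : (0 < q ^ i)%N.
Proof. by rewrite expn_gt0 (ltnW (finNzRing_gt1 F)). Qed.

Lemma expn_card_leq i k : (q ^ i <= q ^ k)%N = (i <= k)%N.
Proof. exact/leq_exp2l/finNzRing_gt1. Qed.

Lemma expn_card_ltn i k : (q ^ i < q ^ k)%N = (i < k)%N.
Proof. exact/ltn_exp2l/finNzRing_gt1. Qed.

Lemma rank_order k : (q ^ k - 1).+1 = (q ^ k)%N.
Proof. by rewrite -addn1 subnK ?card_field_gt0. Qed.

Lemma degree_split k : (q ^ k - 1 + (q ^ (2 * k) - q ^ k) = q ^ (2 * k) - 1)%N.
Proof.
have : (q ^ k <= q ^ (2 * k))%N by rewrite expn_card_leq leq_pmull.
by have := card_field_gt0 k; move: (q ^ k)%N (q ^ (2 * k))%N => u v; lia.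
Qed.

Lemma corank_gt0 k : (0 < k)%N -> (0 < q ^ (2 * k) - q ^ k)%N.
Proof.
by move=> k_gt0; rewrite subn_gt0 expn_card_ltn mul2n -addnn -{1}[k]addn0 ltn_add2l.
Qed.

Section Frobenius.
Variables (R : comPzRingType) (f : {rmorphism F -> R}).

Lemma frobeniusD i (x y : R) :
  (x + y) ^+ (q ^ i) = x ^+ (q ^ i) + y ^+ (q ^ i).
Proof.
have [R0|R_nz] := eqVneq (1 : R) 0; first exact: zero_ring_eq.
have [p p_pr pF] := finPcharP F.
have pR : p \in [pchar (nonzero_ring R_nz)].
  rewrite inE p_pr /=; apply/eqP; change ((p%:R : R) = 0).
  by rewrite -(rmorph_nat f) (pcharf0 pF) rmorph0.
apply: (@exprDn_pchar (nonzero_ring R_nz)).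
rewrite (eq_pnat _ (pcharf_eq pR)) pnatX; apply/orP; left.
by have := abelem_pgroup (fin_ring_pchar_abelem pF); rewrite /pgroup cardsT.
Qed.

Lemma frobenius_sum i (I : Type) (r : seq I) P (G : I -> R) :
  (\sum_(k <- r | P k) G k) ^+ (q ^ i) = \sum_(k <- r | P k) G k ^+ (q ^ i).
Proof.
have q_gt0 := card_field_gt0 i.
by apply: (big_morph (fun x => x ^+ (q ^ i))) => [x y|]; rewrite ?frobeniusD ?expr0n ?gtn_eqF.
Qed.

End Frobenius.

(* Otherwise every element of the field F[t]/wp, which has q^d elements,      *)
(* would be a root of Y^(q^h) - Y.                                            *)
Lemma coprimep_artin_schreier (wp : {poly F}) h :
  wp \is monic -> irreducible_poly wp -> (0 < h < pdeg wp)%N ->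
  coprimep wp ('X^(q ^ h) - 'X).
Proof.
move=> wp_monic wp_irr /andP[h_gt0 h_lt].
have q_gt1 : (1 < q)%N := finNzRing_gt1 F.
rewrite irreducible_poly_coprime //; apply/negP => wp_dvd.
have frob (a : {poly F}) : wp %| a ^+ (q ^ h) - a.
  elim/poly_ind: a => [|a c IHa].
    by rewrite expr0n gtn_eqF ?subr0 ?dvdp0 // card_field_gt0.
  rewrite (frobeniusD (polyC : {rmorphism F -> {poly F}})) exprMn -rmorphXn /=.
  have -> : c ^+ (q ^ h) = c.
    by elim: (h) => [|n IHn]; rewrite ?expn0 ?expr1 // expnS exprM expf_card.
  have -> : a ^+ (q ^ h) * 'X^(q ^ h) + c%:P - (a * 'X + c%:P) =
    (a ^+ (q ^ h) - a) * 'X^(q ^ h) + a * ('X^(q ^ h) - 'X) by ring.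
  by apply: dvdp_add; [apply: dvdp_mulr | apply: dvdp_mull].
have mi : monic_irreducible_poly wp by split.
pose K := {poly %/ wp with mi}.
have roots : all (root ('X^(q ^ h) - 'X : {poly K})) (enum K).
  apply/allP => y _; rewrite rootE !hornerE subr_eq0.
  have rmodpE (u : {poly F}) :
      Pdiv.Ring.rmodp u (mk_monic wp) = Pdiv.Ring.rmodp u wp.
    by rewrite (mk_monicE mi).
  apply/eqP/val_inj; rewrite [LHS](@poly_of_qpolyX F wp y) rmodpE.
  rewrite -[RHS](@Pdiv.CommonRing.rmodp_small _ _ (mk_monic wp)) ?rmodpE; last first.
    exact: size_mk_monic.
  apply/eqP; rewrite -subr_eq0 -Pdiv.RingMonic.rmodpB //.
  by have := frob (val y); rewrite dvdpE.
have size_p : size ('X^(q ^ h) - 'X : {poly K}) = (q ^ h).+1.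
  rewrite size_polyDl size_polyXn // size_polyN size_polyX ltnS.
  apply: (leq_trans q_gt1); rewrite -[X in (X <= _)%N]expn1.
  by rewrite leq_exp2l //; apply: q_gt1.
have p_neq0 : ('X^(q ^ h) - 'X : {poly K}) != 0 by rewrite -size_poly_gt0 size_p.
have := max_poly_roots p_neq0 roots (enum_uniq _).
rewrite -cardE card_qfpoly size_p ltnS leq_exp2l //.
by rewrite leqNgt h_lt.
Qed.

End FiniteFieldAlgebras.

(** * Coefficients of Drinfeld modules *)

Section Coefs.
Variables (F : finFieldType) (r : nat) (B : comPzRingType).
Variables (gamma : {rmorphism {poly F} -> B}) (E : drinfeld_module r gamma).
Variables (sz : nat) (ch : charts sz E).
Local Notation q := #|F|.
Local Notation S := (lb_ring E).
Local Notation str := (lb_str E).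
Local Notation coord := (@lb_coord B E).
Local Notation X := (chX ch).
Local Notation a := (chA ch).
Local Notation e := (ch_vec ch).

Definition base_hom : {rmorphism F -> B} := gamma \o polyC.

(** Extension of [dm_coef] by zero, so that sums over i may run up to any sufficiently large
    bound. *)
Definition coef (x : {poly F}) (i : nat) : S :=
  if (x != 0) && (i <= r * pdeg x)%N then dm_coef E x i else 0.

Lemma coefE x i : x != 0 -> (i <= r * pdeg x)%N -> coef x i = dm_coef E x i.
Proof. by rewrite /coef => -> ->. Qed.

Lemma coef0 x : x != 0 -> coef x 0 = str (gamma x).
Proof. by move=> x0; rewrite coefE // dm_coef0. Qed.

Lemma coef_homog x i : homog ch (q ^ i - 1) (coef x i).
Proof.
rewrite /coef; case: ifP => [/andP[x0 ix]|_]; last exact: homog0.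
exact/sym_degree_homog/dm_coef_degree.
Qed.

Lemma phi_coord x K f : (r * pdeg x < K)%N ->
  dm_phi E x (coord f) = (\sum_(i < K) coef x i) * coord f.
Proof.
move=> xK; have [->|x0] := eqVneq x 0.
  rewrite big1 ?mul0r => [|i _]; last by rewrite /coef eqxx.
  by have := dm_phiC 0 f; rewrite polyC0 !rmorph0 mul0r.
rewrite dm_phiE // mulr_suml.
rewrite (big_ord_widen_cond K xpredT (fun i => dm_coef E x i * coord f)) //=.
rewrite big_mkcond /=; apply: eq_bigr => i _.
by rewrite /coef x0 /= ltnS; case: ifP; rewrite ?mul0r.
Qed.

(** The summands have distinct degrees q^i - 1, and X j cancels on D(a j). Identities between
    coefficients are deduced in this way from identities between comorphisms. *)
Lemma coef_unique (c c' : nat -> S) K :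
  (forall i, homog ch (q ^ i - 1) (c i)) ->
  (forall i, homog ch (q ^ i - 1) (c' i)) ->
  (forall j, (\sum_(i < K) c i) * X j = (\sum_(i < K) c' i) * X j) ->
  forall i, (i < K)%N -> c i = c' i.
Proof.
move=> ch_c ch_c' cc' m mK; apply: (chi_inj (ch := ch)) => i n.
have [->|nm] := eqVneq n (q ^ m - 1)%N; last by rewrite ch_c // ch_c'.
apply/eqP; rewrite -subr_eq0 -chiB; apply/eqP; set n0 := (q ^ m - 1)%N.
pose J := [set b | b * chi (e i) (c m - c' m) n0 = 0].
have Ji : is_ideal J.
  split=> [|x y|s x]; rewrite /J /= ?mul0r // ?mulrDl -?mulrA.
    by move=> -> ->; rewrite addr0.
  by move=> ->; rewrite mulr0.
suff : J 1 by rewrite /J /= mul1r.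
apply: (chart_local_to_global (ch := ch) Ji) => j; exists n0.+1.
have top d : (forall i, homog ch (q ^ i - 1) (d i)) ->
    chi (e j) ((\sum_(i < K) d i) * X j) (q ^ m) = chi (e j) (d m) n0 * a j.
  move=> d_homog.
  have Xh k' : k' != 1%N -> chi (e j) (X j) k' = 0 by apply: homog_coord.
  have -> : (q ^ m = n0 + 1)%N by rewrite subnK ?card_field_gt0.
  rewrite (chi_mul_homog _ _ Xh) chi_coord eqxx mulr1n chi_sum.
  rewrite (bigD1 (Ordinal mK)) //= big1 ?addr0 // => i' /negP i'm.
  apply: d_homog; apply/negP => /eqP E'; apply: i'm; apply/eqP/val_inj => /=.
  have := card_field_gt0 F m; have := card_field_gt0 F i'.
  move=> h1 h2; have : (q ^ i' == q ^ m)%N by rewrite /n0 in E'; apply/eqP; lia.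
  by rewrite eqn_exp2l ?finNzRing_gt1 // => /eqP.
have cj : a j * chi (e j) (c m - c' m) n0 = 0.
  rewrite chiB mulrBr ![a j * _]mulrC -!top //.
  by rewrite cc' subrr.
by rewrite /J /= exprS -mulrA chi_chart mulrCA cj mulr0.
Qed.

(** By linearity it suffices to take s = X_j^(q^i), where the claim is the q^i-th power of the
    formula for X_j, distributed by additivity of Frobenius. *)
Lemma phi_sum_frobenius y i K s : (r * pdeg y < K)%N -> homog ch (q ^ i) s ->
  dm_phi E y s = s * \sum_(k < K) coef y k ^+ (q ^ i).
Proof.
move=> yK s_homog; set c := \sum_(k < K) _.
pose N := [set s | dm_phi E y s = s * c].
apply: (homog_span (K := N)) s_homog _.
  split=> [|u v|b u]; rewrite /N /= ?rmorph0 ?mul0r // ?rmorphD ?rmorphM ?mulrDl.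
    by move=> -> ->.
  by rewrite dm_phi_str -mulrA => ->.
move=> j; rewrite /N /= rmorphXn /= (phi_coord _ yK) exprMn mulrC; congr (_ * _).
exact: (frobenius_sum (str \o base_hom)).
Qed.

(** The rule (alpha tau^i)(beta tau^k) = alpha beta^(q^i) tau^(i+k) of the twisted polynomial
    ring. *)
Lemma coefM x y m K : (r * pdeg x < K)%N -> (r * pdeg y < K)%N ->
  coef (x * y) m = \sum_(p : 'I_K * 'I_K | (p.1 + p.2 == m)%N)
    coef x p.1 * coef y p.2 ^+ (q ^ p.1).
Proof.
move=> xK yK.
pose c n := \sum_(p : 'I_K * 'I_K | (p.1 + p.2 == n)%N)
  coef x p.1 * coef y p.2 ^+ (q ^ p.1).
pose M := (maxn m.+1 (maxn (r * pdeg (x * y)).+1 (K + K)))%N.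
apply: (@coef_unique (coef (x * y)) c M) => [i|i|j|]; last first.
- by rewrite /M leq_max ltnSn.
- have xyM : (r * pdeg (x * y) < M)%N by rewrite /M !leq_max ltnSn orbT.
  rewrite -(phi_coord _ xyM) dm_phiM (phi_coord _ xK) mulr_suml rmorph_sum.
  have -> : \sum_(n < M) c n = \sum_(p : 'I_K * 'I_K) coef x p.1 * coef y p.2 ^+ (q ^ p.1).
    have pM (p : 'I_K * 'I_K) : (p.1 + p.2 < M)%N.
      rewrite /M !leq_max; do 2![apply/orP; right].
      by have := ltn_ord p.1; have := ltn_ord p.2; lia.
    rewrite [RHS](partition_big (fun p => Ordinal (pM p)) xpredT) //=.
  rewrite -(pair_big xpredT xpredT (fun i k : 'I_K => coef x i * coef y k ^+ (q ^ i))) /=.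
  rewrite mulr_suml; apply: eq_bigr => i _; rewrite (phi_sum_frobenius yK (i := i)).
    by rewrite mulrAC mulr_sumr.
  have -> : (q ^ i = (q ^ i - 1) + 1)%N by rewrite subnK ?card_field_gt0.
  by apply: homogM; [apply: coef_homog | apply: homog_coord].
- apply: homog_sum => p /eqP <-.
  have -> : (q ^ (p.1 + p.2) - 1 = (q ^ p.1 - 1) + (q ^ p.2 - 1) * q ^ p.1)%N.
    rewrite expnD; have := card_field_gt0 F p.1; have := card_field_gt0 F p.2.
    move: (q ^ p.1)%N (q ^ p.2)%N => u v; nia.
  by apply: homogM; [|apply: homogX]; apply: coef_homog.
- exact: coef_homog.
Qed.

Lemma coefM_cong (J : set S) x y i k : is_ideal J ->
  (forall i' k', (i' + k' = i + k)%N -> i' != i ->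
    J (coef x i' * coef y k' ^+ (q ^ i'))) ->
  J (coef (x * y) (i + k) - coef x i * coef y k ^+ (q ^ i)).
Proof.
move=> Ji small.
pose K := (maxn (maxn i.+1 k.+1) (maxn (r * pdeg x).+1 (r * pdeg y).+1))%N.
have iK : (i < K)%N by rewrite !leq_max ltnSn.
have kK : (k < K)%N by rewrite !leq_max ltnSn orbT.
rewrite (@coefM _ _ _ K) ?leq_max ?ltnSn ?orbT //.
rewrite (bigD1 (Ordinal iK, Ordinal kK)) //= addrAC subrr add0r.
apply: (ideal_sum Ji) => -[i' k'] /= /andP[/eqP ik ne].
apply: small => //; apply: contraNneq ne => i'i.
apply/eqP; congr pair; apply: val_inj => //=.
by rewrite i'i in ik; apply: (addnI ik).
Qed.

End Coefs.

Arguments coef {F r B gamma} E x i.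

(** * The torsion algebra and its idempotents *)

Section Core.
Variables (B : comPzRingType) (V : line_bundle B) (sz : nat) (ch : charts sz V).
Local Notation S := (lb_ring V).
Local Notation str := (lb_str V).
Local Notation coord := (@lb_coord B V).
Local Notation X := (chX ch).
Local Notation a := (chA ch).
Local Notation e := (ch_vec ch).
Local Notation l := (ch_form ch).
Local Notation sact := (fun b s => str b * s).

Lemma str_action : is_action sact.
Proof.
split=> [x|b c x|b x y|b c x]; first by rewrite rmorph1 mul1r.
- by rewrite rmorphM mulrA.
- by rewrite mulrDr.
- by rewrite rmorphD mulrDl.
Qed.

Lemma ideal_submodule (J : set S) : is_ideal J -> is_submodule sact J.
Proof.
move=> Ji; split=> [|x y|b x]; [exact: ideal0|exact: idealD|exact: idealMl].
Qed.

Lemma principal_chi (w : B) s :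
  (forall i m, principal w (chi (e i) s m)) -> principal (str w) s.
Proof.
move=> ws; have [K sK] := deg_lt_exists ch s; rewrite (expansion sK).
have Wi := principal_ideal (str w).
apply: (ideal_sum Wi) => m _; apply: (ideal_sum Wi) => i _.
rewrite rmorphM; apply: (idealMr Wi).
by apply: (idealMl Wi); have [c ->] := ws i m; rewrite rmorphM; apply: principal_mul.
Qed.

Lemma chi_principal (w : B) s v m : principal (str w) s -> principal w (chi v s m).
Proof. by case=> c ->; rewrite chiZ; apply: principal_mul. Qed.

Definition reducible (J : set S) m s := exists2 y, deg_lt ch m y & J (s - y).

Lemma reducible_submodule J m : is_ideal J -> is_submodule sact (reducible J m).
Proof.
move=> Ji; split.
- by exists 0; rewrite ?subrr; [apply: deg_lt0 | apply: ideal0].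
- move=> s t [y ym Jy] [z zm Jz]; exists (y + z); first exact: deg_ltD.
  by rewrite opprD addrACA; apply: idealD.
- move=> b s [y ym Jy]; exists (str b * y); first exact: deg_ltZ.
  by rewrite -mulrBr; apply: idealMl.
Qed.

(** Division with remainder: multiplying a remainder by X j raises its degree to at most m, and the
    part of degree m is reduced again. *)
Lemma reducible_all J m : is_ideal J -> (0 < m)%N ->
  (forall j, reducible J m (X j ^+ m)) -> forall s, reducible J m s.
Proof.
move=> Ji m_gt0 JX s; have Ks := reducible_submodule m Ji.
have low t : deg_lt ch m t -> reducible J m t.
  by move=> tm; exists t => //; rewrite subrr; apply: ideal0.
have lowS t : deg_lt ch m.+1 t -> reducible J m t.
  move=> tm; apply: (span_monomials Ks tm) => i k; rewrite ltnS leq_eqVlt.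
  by case/orP=> [/eqP->|km] //; apply/low/(homog_deg_lt km)/homog_monomial.
have mulX t j : reducible J m t -> reducible J m (X j * t).
  case=> y ym Jy; have [z zm Jz] : reducible J m (X j * y).
    apply: lowS; rewrite -add1n; apply: deg_ltM ym.
    exact: (homog_deg_lt _ (homog_coord _ _)).
  exists z => //; apply: (ideal_trans Ji) Jz; rewrite -mulrBr; exact: idealMl.
have [K sK] := deg_lt_exists ch s.
apply: (span_monomials Ks sK) => i k _; elim: k => [|k IHk].
  by apply/low/(homog_deg_lt m_gt0); rewrite expr0; apply: homog1.
by rewrite exprS; apply: mulX.
Qed.

(** Descending induction on the degree in t: the top coefficient of t p is a product of top
    coefficients, and that of p divides a power of a j. *)
Lemma lead_cancel j t p n b k :
  (forall m, (n < m)%N -> chi (e j) p m = 0) ->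
  chi (e j) p n * b = a j ^+ k ->
  (forall m, (n <= m)%N -> chi (e j) (t * p) m = 0) ->
  exists M, forall m, a j ^+ M * chi (e j) t m = 0.
Proof.
move=> p_deg p_lead tp0; have [K tK] := chi_finite (e j) t.
suff H i : exists M, forall m, (K <= m + i)%N -> a j ^+ M * chi (e j) t m = 0.
  by have [M MP] := H K; exists M => m; apply: MP; apply: leq_addl.
elim: i => [|i [M MP]].
  by exists 0%N => m; rewrite addn0 => /tK ->; rewrite mulr0.
exists (M + k)%N => m Km; rewrite exprD -p_lead.
suff : a j ^+ M * (chi (e j) t m * chi (e j) p n) = 0.
  by move=> H; rewrite -mulrA [_ * b]mulrC -mulrA mulrCA [_ * chi _ t m]mulrC H mulr0.
have := tp0 (m + n)%N (leq_addl _ _); rewrite chiM.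
have le_m : (m < (m + n).+1)%N by rewrite ltnS leq_addr.
move=> /(congr1 ( *%R (a j ^+ M))); rewrite mulr0 => <-.
rewrite mulr_sumr (bigD1 (Ordinal le_m)) //= addKn big1 ?addr0 // => k' ne.
have {}ne : (k' : nat) <> m by move=> h; case/eqP: ne; apply: val_inj.
have [k'm|mk'] := ltnP k' m; first by rewrite p_deg ?mulr0 //; lia.
rewrite mulrA MP ?mul0r //; lia.
Qed.

Variables (beta : S) (N1 M : nat).
Local Notation N := N1.+1.
Local Notation D := (N1 + M).+1.
Hypothesis M_gt0 : (0 < M)%N.

Definition generates n s := forall j, exists b, X j ^+ n = str b * s.

(** In a trivialisation of L, a polynomial of degree n with invertible leading coefficient. *)
Definition unit_top n s :=
  exists top, [/\ homog ch n top, generates n top & deg_lt ch n (s - top)].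

Hypothesis beta_top : unit_top (N1 + M) beta.

Definition torsion : set S := ideal_gen (range (fun f => beta * coord f)).
Local Notation I := torsion.

Lemma torsion_is_ideal : is_ideal I. Proof. exact: ideal_gen_ideal. Qed.
Local Notation Ii := torsion_is_ideal.

Lemma beta_coord_torsion f : I (beta * coord f).
Proof. by apply: sub_ideal_gen; exists f. Qed.

Lemma torsion_reducible s : reducible I D s.
Proof.
apply: (reducible_all Ii) => // j.
have [top [top_homog top_gen low]] := beta_top.
have [b bX] := top_gen j; exists (- (str b * ((beta - top) * X j))).
  apply/deg_ltN/deg_ltZ; rewrite mulrC -add1n; apply: deg_ltM low.
  exact: (homog_deg_lt _ (homog_coord _ _)).
have -> : X j ^+ D - - (str b * ((beta - top) * X j)) = str b * (beta * X j).
  rewrite exprSr bX; ring.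
by apply: (idealMl Ii); apply: beta_coord_torsion.
Qed.

(** On D(a j) the torsion ideal is generated by beta X_j, of degree D with invertible leading
    coefficient, so a multiple of degree < D is zero. With [torsion_reducible] this gives unique
    remainders. *)
Lemma torsion_deg_lt0 s : I s -> deg_lt ch D s -> s = 0.
Proof.
move=> Is sD; have [top [top_homog top_gen low]] := beta_top.
have local j : exists M', forall m, a j ^+ M' * chi (e j) s m = 0.
  have [t tE] : exists t, str (a j) * s = t * (beta * X j).
    pose J := [set s | exists t, str (a j) * s = t * (beta * X j)].
    have Ji : is_ideal J.
      split=> [|x y [t tx] [u uy]|x y [t ty]].
      - by exists 0; rewrite mulr0 mul0r.
      - by exists (t + u); rewrite mulrDr tx uy mulrDl.
      - by exists (x * t); rewrite mulrCA ty; ring.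
    apply: (ideal_gen_min Ji) Is => _ [f _ <-]; exists (str (f (e j))).
    by rewrite mulrCA coord_chart mulrCA.
  have Xh k : k != 1%N -> chi (e j) (X j) k = 0 by apply: homog_coord.
  have chi_bX m : chi (e j) (beta * X j) m.+1 = chi (e j) beta m * a j.
    by rewrite -addn1 (chi_mul_homog _ _ Xh) chi_coord eqxx.
  have chi_top m : (N1 + M <= m)%N -> chi (e j) beta m = chi (e j) top m.
    by move=> mD; apply/eqP; rewrite -subr_eq0 -chiB low.
  have [b bX] := top_gen j.
  have [M' MP] : exists M', forall m, a j ^+ M' * chi (e j) t m = 0.
    apply: (@lead_cancel j t (beta * X j) D b D).
    - case=> // m mD; have mD' : (N1 + M < m)%N by [].
      by rewrite chi_bX chi_top ?top_homog ?mul0r ?gtn_eqF // ltnW.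
    - rewrite chi_bX chi_top // mulrAC exprSr; congr (_ * _).
      have := congr1 (fun s => chi (e j) s (N1 + M)%N) bX.
      by rewrite chi_monomial eqxx chiZ mulr1n => ->; rewrite mulrC.
    - by move=> m mD; rewrite -tE chiZ sD ?mulr0.
  exists M'.+1 => m; rewrite exprSr -mulrA -chiZ tE chiM mulr_sumr big1 // => k _.
  by rewrite mulrA MP mul0r.
apply: (chi_eq0 (ch := ch)) => i m.
pose J := [set b | b * chi (e i) s m = 0].
have Ji : is_ideal J.
  split=> [|x y|c x]; rewrite /J /= ?mul0r // ?mulrDl -?mulrA.
    by move=> -> ->; rewrite addr0.
  by move=> ->; rewrite mulr0.
suff : J 1 by rewrite /J /= mul1r.
apply: (chart_local_to_global (ch := ch) Ji) => j.
have [M' MP] := local j; exists (M' + m)%N.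
by rewrite /J /= exprD -mulrA chi_chart mulrCA MP mulr0.
Qed.

Section Adic.
Variable w : B.
Hypothesis w_complete : adically_complete w.
Local Notation W := (principal (str w)).
Local Notation Wi := (principal_ideal (str w)).

Let generators : seq S := [seq X p.1 ^+ p.2 | p : 'I_sz * 'I_D].

Lemma deg_lt_span s : deg_lt ch D s -> span sact generators s.
Proof.
move=> sD; apply: (span_monomials _ sD) => [|i m mD].
  exact: (span_submodule str_action).
apply: (mem_span str_action); rewrite /generators.
by apply/mapP; exists (i, Ordinal mD) => //; rewrite mem_enum inE.
Qed.

(** S/I is spanned over B by finitely many monomials, so Nakayama's lemma applies to its quotient
    S/K. *)
Lemma torsion_nakayama (K : set S) : is_submodule sact K -> I `<=` K ->
  (forall s, exists2 k, K k & W (s - k)) -> forall s, K s.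
Proof.
move=> Ks IK KW s.
have gen t : exists2 y, span sact generators y & I (t - y).
  by have [y /deg_lt_span] := torsion_reducible t; exists y.
have wU := complete_unit w_complete.
have GK : span sact generators `<=` K.
  apply: (nakayama str_action wU Ks) => g _.
  have [k Kk [t tE]] := KW g; have [y Gy Iy] := gen t; exists y => //.
  have -> : g - str w * y = k + str w * (t - y) by rewrite mulrBr -tE; ring.
  by apply: (submodD Ks) => //; apply/(submodZ Ks)/IK.
have [y /GK Ky /IK] := gen s; exact: (fun h => submodD_cancel Ks h Ky).
Qed.

Lemma reducible_nakayama (J : set S) m : is_ideal J -> I `<=` J -> (0 < m)%N ->
  (forall j, reducible (ideal_add J W) m (X j ^+ m)) -> forall s, reducible J m s.
Proof.
move=> Ji IJ m_gt0 JX; apply: torsion_nakayama.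
- exact: reducible_submodule.
- move=> s Is; exists 0; first exact: deg_lt0.
  by rewrite subr0; apply: IJ.
- move=> s; have [y ym [c [t [Jc Wt E]]]] :=
    reducible_all (ideal_add_ideal Ji Wi) m_gt0 JX s.
  exists (y + c); last by rewrite opprD addrA E addrAC subrr add0r.
  by exists y => //; rewrite addrAC subrr add0r.
Qed.

Local Notation Q n := (ideal_add I (principal (str w ^+ n))).
Let Qi n : is_ideal (Q n) := ideal_add_ideal Ii (principal_ideal (str w ^+ n)).

(** By uniqueness of remainders, the remainder of s is divisible by w^n for every n; its
    coefficients then vanish because B is separated. *)
Lemma torsion_separated s : (forall n, Q n s) -> I s.
Proof.
move=> Qs; have [y yD Iy] := torsion_reducible s.
suff y0 : y = 0 by rewrite y0 subr0 in Iy.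
have yE n : exists2 t, deg_lt ch D t & y = str (w ^+ n) * t.
  have [i [_ [Ii' [t ->] E]]] := Qs n; have [z zD Iz] := torsion_reducible t.
  exists z => //; apply/eqP; rewrite -subr_eq0; apply/eqP.
  apply: torsion_deg_lt0; last by apply: deg_ltD => //; apply/deg_ltN/deg_ltZ.
  have -> : y - str (w ^+ n) * z = i - (s - y) + str (w ^+ n) * (t - z).
    by rewrite E rmorphXn; ring.
  by apply: (idealD Ii); [apply: (idealB Ii) | apply: (idealMl Ii)].
apply: (chi_eq0 (ch := ch)) => i m; case: w_complete => sep _; apply: sep => n.
by have [t _ ->] := yE n; rewrite chiZ; apply: principal_mul.
Qed.

(* Newton's iteration for the equation x^2 = x.                               *)
Lemma idempotent_lift (h : S) : Q 1 (h ^+ 2 - h) ->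
  exists2 eps, I (eps ^+ 2 - eps) & Q 1 (eps - h).
Proof.
move=> hh; pose E := fix E n : S := if n is n'.+1 then E n' ^+ 2 *+ 3 - E n' ^+ 3 *+ 2 else h.
have EQ n : Q n.+1 (E n ^+ 2 - E n).
  elim: n => [//|n [i [_ [Ii' [t ->] dE]]]] /=; set x := E n in dE *.
  have -> : (x ^+ 2 *+ 3 - x ^+ 3 *+ 2) ^+ 2 - (x ^+ 2 *+ 3 - x ^+ 3 *+ 2)
     = (x ^+ 2 - x) ^+ 2 * (x ^+ 2 *+ 4 - x *+ 4 - 3%:R) by ring.
  apply: (idealMr (Qi _)); rewrite dE.
  exists (i * (i + str w ^+ n.+1 * t *+ 2)), (str w ^+ n.+2 * (str w ^+ n * t ^+ 2)).
  split; [exact: (idealMr Ii) | exact: principal_mul|].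
  by rewrite !exprS; ring.
have ES n : Q n.+1 (E n.+1 - E n).
  have -> : E n.+1 - E n = (E n ^+ 2 - E n) * (1 - E n *+ 2) by rewrite /=; ring.
  exact/(idealMr (Qi _))/EQ.
(* The limit of the iterates is taken coefficientwise in finitely many monomials, so that only
   completeness of B is needed. *)
pose comb (b : 'I_D * 'I_sz -> B) := \sum_p str (b p) * X p.2 ^+ p.1.
have combD b c x : comb (fun p => b p + x * c p) = comb b + str x * comb c.
  rewrite mulr_sumr -big_split; apply: eq_bigr => p _.
  by rewrite rmorphD rmorphM /=; ring.
have comb_exists s : exists b, I (s - comb b).
  have [y yD Iy] := torsion_reducible s.
  exists (fun p : 'I_D * 'I_sz => weight ch p.1 p.2 * chi (e p.2) y p.1); rewrite /comb.
  rewrite -(pair_big xpredT xpredT (fun (m : 'I_D) i =>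
    str (weight ch m i * chi (e i) y m) * X i ^+ m)) /=.
  by rewrite -(expansion yD).
have step n : exists c, I (E n.+1 - E n - str (w ^+ n.+1) * comb c).
  have [i [_ [Ii' [t ->] ->]]] := ES n; have [c Ic] := comb_exists t; exists c.
  have -> : i + str w ^+ n.+1 * t - str (w ^+ n.+1) * comb c
    = i + str (w ^+ n.+1) * (t - comb c) by rewrite rmorphXn; ring.
  by apply: (idealD Ii) => //; apply: (idealMl Ii).
have [c cP] := choice step; have [b0 b0P] := comb_exists h.
pose b := fix b n := if n is n'.+1 then (fun p => b n' p + w ^+ n * c n' p) else b0.
have bP n : I (E n - comb (b n)).
  elim: n => [//|n IHn].
  have -> : comb (b n.+1) = comb (b n) + str (w ^+ n.+1) * comb (c n) by exact: combD.
  have -> : E n.+1 - (comb (b n) + str (w ^+ n.+1) * comb (c n))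
     = (E n - comb (b n)) + (E n.+1 - E n - str (w ^+ n.+1) * comb (c n)) by ring.
  exact: (idealD Ii).
have lim p : exists x, forall n, principal (w ^+ n) (x - b n p).
  case: w_complete => _; apply => n /=; rewrite addrAC subrr add0r exprSr -mulrA.
  exact: principal_mul.
have [x xP] := fin_all_exists lim.
have xQ n : Q n (comb x - E n).
  have -> : comb x - E n = - (E n - comb (b n)) + (comb x - comb (b n)) by ring.
  apply: (idealD (Qi n)).
    by apply: (ideal_addl (principal_ideal _)); apply: (idealN Ii).
  apply: (ideal_addr Ii); rewrite -sumrB; apply: (ideal_sum (principal_ideal _)) => p _.
  rewrite -mulrBl -rmorphB; apply: (idealMr (principal_ideal _)).
  by have [y ->] := xP p n; rewrite rmorphM rmorphXn; apply: principal_mul.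
exists (comb x).
  apply: torsion_separated => n.
  have -> : comb x ^+ 2 - comb x = (comb x - E n) * (comb x + E n - 1)
    + (E n ^+ 2 - E n) by ring.
  apply: (idealD (Qi n)); first by apply: (idealMr (Qi n)).
  have [i [_ [Ii' [t ->] ->]]] := EQ n; exists i, (str w ^+ n * (str w * t)).
  by split=> //; [exact: principal_mul | rewrite exprSr mulrA].
have -> : comb x - h = comb x - E 1%N + (E 1%N - E 0%N) by rewrite /=; ring.
by apply: (idealD (Qi 1)).
Qed.

Definition monomial_ideal n : set S := ideal_gen (range (fun j => X j ^+ n)).
Definition component eps : set S := ideal_add (principal eps) I.

Lemma component_ideal eps : is_ideal (component eps).
Proof. exact: ideal_add_ideal (principal_ideal _) Ii. Qed.

Lemma component_torsion eps : I `<=` component eps.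
Proof. by move=> s; apply: (ideal_addr (principal_ideal _)). Qed.

Lemma component_self eps : component eps eps.
Proof. by apply: (ideal_addl Ii); exists 1; rewrite mulr1. Qed.

(* eps vanishes on the canonical subgroup, of rank N, and is 1 on its         *)
(* complement in the torsion scheme, of rank M.                               *)
Definition canonical_idempotent eps : Prop :=
  [/\ I (eps ^+ 2 - eps),
      component eps `<=` ideal_add (monomial_ideal N) W,
      forall j, ideal_add (component eps) W (X j ^+ N) &
      forall j, reducible (ideal_add (component (1 - eps)) W) M (X j ^+ M)].

(* The powers X i ^+ m with m < N are independent on the component: a relation *)
(* p times a G of degree M vanishing on the complement has degree < D and     *)
(* lies in the torsion ideal, so it is zero, and G has an invertible leading  *)
(* coefficient on D(a i).                                                     *)
Lemma component_locally_free eps : canonical_idempotent eps ->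
  locally_free sact (component eps) setT.
Proof.
case=> eps_idem _ epsX epsX'.
have Ci := component_ideal eps; have Ci' := component_ideal (1 - eps).
have red s : reducible (component eps) N s.
  apply: (reducible_nakayama Ci (@component_torsion _)) => // j.
  by exists 0; rewrite ?subr0 //; apply: deg_lt0.
have red' s : reducible (component (1 - eps)) M s.
  exact: (reducible_nakayama Ci' (@component_torsion _)).
have prodI s t : component eps s -> component (1 - eps) t -> I (s * t).
  move=> [_ [i [[c ->] Iis ->]]] [_ [i' [[c' ->] Iit ->]]].
  have -> : (eps * c + i) * ((1 - eps) * c' + i') =
    - (eps ^+ 2 - eps) * (c * c') + i * ((1 - eps) * c' + i') + eps * c * i' by ring.
  apply: (idealD Ii); last exact: (idealMl Ii).
  by apply: (idealD Ii); apply: (idealMr Ii) => //; apply: (idealN Ii).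
exists sz, a, (ch_weight ch); split; first exact: ch_sum1.
move=> i; exists N => //; exists (fun m => X i ^+ m); split=> [s|b].
  (* On D(a i), y is the sum of the chi (e i) y m X_i^m / a_i^m; the factor a_i^N clears these
     denominators. *)
  have [y yN Cy] := red s; exists N, (fun m : 'I_N => a i ^+ (N - m) * chi (e i) y m).
  suff -> : \sum_(m < N) str (a i ^+ (N - m) * chi (e i) y m) * X i ^+ m
      = str (a i ^+ N) * y by rewrite -mulrBr; apply: (idealMl Ci).
  apply: (chi_inj (ch := ch)) => j k; rewrite chi_sum chiZ.
  under eq_bigr do rewrite chiZ chi_monomial.
  have [kN|kN] := ltnP k N; last first.
    rewrite yN // mulr0 big1 // => m _.
    by rewrite [k == m]gtn_eqF ?mulr0n ?mulr0 // (leq_trans (ltn_ord m)).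
  rewrite (bigD1 (Ordinal kN)) //= eqxx mulr1n big1 ?addr0.
    by rewrite -{2}(subnK (ltnW kN)) exprD -!mulrA chi_chart [chi _ _ _ * _]mulrC.
  move=> m mk; rewrite eq_sym; case: eqP => [mk'|]; last by rewrite mulr0.
  by case/eqP: mk; apply: val_inj.
set p := \sum_(m < N) _ => Cp.
have pN : deg_lt ch N p.
  apply: deg_lt_sum => m _; apply/deg_ltZ/(homog_deg_lt (ltn_ord m)).
  exact: homog_monomial.
have chi_p (m : 'I_N) : chi (e i) p m = b m * a i ^+ m.
  rewrite chi_sum (bigD1 m) //= chiZ chi_monomial eqxx mulr1n big1 ?addr0 //.
  move=> k km; rewrite chiZ chi_monomial eq_sym; case: eqP => [E|]; last by rewrite mulr0.
  by case/eqP: km; apply: val_inj.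
have [y yM Cy] := red' (X i ^+ M); set G := X i ^+ M - y in Cy.
have pG0 : p * G = 0.
  apply: torsion_deg_lt0; first exact: prodI.
  apply: (deg_ltS (D := N1 + M.+1)); first by rewrite addnS.
  apply: deg_ltM => //; apply: deg_ltD; last exact/deg_ltN/(deg_ltS _ yM).
  exact/(homog_deg_lt (ltnSn _))/homog_monomial.
have [M' MP] : exists M', forall m, a i ^+ M' * chi (e i) p m = 0.
  apply: (@lead_cancel i p G M 1 M).
  - move=> m mM; rewrite chiB chi_monomial gtn_eqF // mulr0n yM ?subr0 //.
    exact: ltnW.
  - by rewrite mulr1 chiB chi_monomial eqxx yM // subr0.
  - by move=> m _; rewrite pG0 chi0.
exists (M' + N)%N => m; rewrite exprD -mulrA.
have -> : a i ^+ N * b m = a i ^+ (N - m) * chi (e i) p m.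
  by rewrite chi_p mulrCA -exprD subnK 1?mulrC // ltnW.
by rewrite mulrCA MP mulr0.
Qed.

End Adic.
End Core.

(** * Base change and reduction of the components *)

Section RingMorphism.
Variables (R T : comPzRingType) (g : {rmorphism R -> T}).

Lemma preimage_ideal (J : set T) : is_ideal J -> is_ideal (g @^-1` J).
Proof.
move=> Ji; split=> [|x y|s x]; rewrite /preimage /= ?rmorph0 ?rmorphD ?rmorphM.
- exact: ideal0.
- exact: idealD.
- exact: idealMl.
Qed.

Lemma principal_base_change s t : principal s t -> principal (g s) (g t).
Proof. by case=> c ->; rewrite rmorphM; apply: principal_mul. Qed.

End RingMorphism.

Section ComponentBaseChange.
Variables (B B' : comPzRingType) (phi : {rmorphism B -> B'}).
Variables (V : line_bundle B) (V' : line_bundle B').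
Variables (lam : lb_mod V -> lb_mod V').
Variables (g : {rmorphism lb_ring V -> lb_ring V'}).
Hypothesis bc : line_bundle_base_change phi lam g.
Variables (sz : nat) (ch : charts sz V) (ch' : charts sz V').
Hypothesis vecE : forall i, ch_vec ch' i = lam (ch_vec ch i).
Hypothesis formE : forall i, chX ch' i = g (chX ch i).

Lemma deg_lt_base_change m s : deg_lt ch m s -> deg_lt ch' m (g s).
Proof.
by move=> sm i k mk; rewrite vecE (chi_base_change bc) sm ?rmorph0.
Qed.

Lemma homog_base_change m s : homog ch m s -> homog ch' m (g s).
Proof.
by move=> sm i k mk; rewrite vecE (chi_base_change bc) sm ?rmorph0.
Qed.

Lemma ideal_add_base_change (J K : set (lb_ring V)) (J' K' : set (lb_ring V')) s :
  (forall x, J x -> J' (g x)) -> (forall x, K x -> K' (g x)) ->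
  ideal_add J K s -> ideal_add J' K' (g s).
Proof.
move=> JJ' KK' [x [y [/JJ' Jx /KK' Ky ->]]]; exists (g x), (g y).
by rewrite rmorphD.
Qed.

Lemma torsion_base_change beta s : torsion beta s -> torsion (g beta) (g s).
Proof.
apply: (ideal_gen_min (J := g @^-1` torsion (g beta))).
  exact/preimage_ideal/ideal_gen_ideal.
move=> _ [f _ <-]; rewrite /preimage /= rmorphM.
by have [f' [_ ->]] := extend_form bc f; apply: beta_coord_torsion.
Qed.

Lemma component_base_change beta eps s :
  component beta eps s -> component (g beta) (g eps) (g s).
Proof.
apply: ideal_add_base_change; first exact: principal_base_change.
exact: torsion_base_change.
Qed.

Lemma monomial_ideal_base_change n s :
  monomial_ideal ch n s -> monomial_ideal ch' n (g s).
Proof.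
apply: (ideal_gen_min (J := g @^-1` monomial_ideal ch' n)).
  exact/preimage_ideal/ideal_gen_ideal.
move=> _ [j _ <-]; rewrite /preimage /= rmorphXn -formE.
by apply: sub_ideal_gen; exists j.
Qed.

(** Every linear form of V' is a combination of the images g (X i), so the torsion ideal of V' is
    generated by images of elements of the one of V. *)
Lemma component_image beta eps :
  ideal_gen (g @` component beta eps) = component (g beta) (g eps).
Proof.
have Ci' := component_ideal (g beta) (g eps).
have Gi := ideal_gen_ideal (g @` component beta eps).
have gG s : component beta eps s -> ideal_gen (g @` component beta eps) (g s).
  by move=> Cs; apply: sub_ideal_gen; exists s.
apply/seteqP; split.
  apply: (ideal_gen_min Ci') => _ [s Cs <-]; exact: component_base_change.
apply: (ideal_add_min Gi) => [_ [c ->]|].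
  by apply: (idealMr Gi); apply: gG; apply: component_self.
apply: (ideal_gen_min Gi) => _ [f' _ <-].
rewrite (homog_expansion (homog_coord ch' f')) mulr_sumr.
apply: (ideal_sum Gi) => i _; rewrite mulrCA; apply: (idealMl Gi).
rewrite expr1 formE -rmorphM; apply: gG; apply: component_torsion.
exact: beta_coord_torsion.
Qed.

Lemma canonical_idempotent_base_change beta N1 M w eps :
  canonical_idempotent ch beta N1 M w eps ->
  canonical_idempotent ch' (g beta) N1 M (phi w) (g eps).
Proof.
have W s : principal (lb_str V w) s -> principal (lb_str V' (phi w)) (g s).
  by rewrite -(bc_str bc); apply: principal_base_change.
case=> eps_idem eps_mon epsX epsX'; split.
- by rewrite -rmorphXn -rmorphB; apply: torsion_base_change.
- rewrite -component_image; apply: ideal_gen_min => [|_ [s Cs <-]].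
    exact: ideal_add_ideal (ideal_gen_ideal _) (principal_ideal _).
  apply: ideal_add_base_change W (eps_mon s Cs).
  exact: monomial_ideal_base_change.
- move=> j; rewrite formE -rmorphXn.
  by apply: ideal_add_base_change W (epsX j); apply: component_base_change.
- move=> j; have [y yM Cy] := epsX' j; exists (g y); first exact: deg_lt_base_change.
  rewrite formE -rmorphXn -rmorphB; apply: ideal_add_base_change W Cy => s.
  by rewrite -(rmorph1 g) -rmorphB; apply: component_base_change.
Qed.

End ComponentBaseChange.

Section Reduction.
Variables (B Bbar : comPzRingType) (pi : {rmorphism B -> Bbar}) (w : B).
Hypothesis quot : is_quotient_by w pi.
Variables (V : line_bundle B) (V' : line_bundle Bbar).
Variables (lam : lb_mod V -> lb_mod V').
Variables (rho : {rmorphism lb_ring V -> lb_ring V'}).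
Hypothesis bc : line_bundle_base_change pi lam rho.
Variables (sz : nat) (ch : charts sz V) (ch' : charts sz V').
Hypothesis vecE : forall i, ch_vec ch' i = lam (ch_vec ch i).
Hypothesis formE : forall i, chX ch' i = rho (chX ch i).
Local Notation W := (principal (lb_str V w)).

Lemma reduction_kernel s : rho s = 0 <-> W s.
Proof.
split=> [s0|[c ->]]; last first.
  rewrite rmorphM (bc_str bc) (quot.2 w).2 ?rmorph0 ?mul0r //.
  by exists 1; rewrite mulr1.
apply: (principal_chi (ch := ch)) => i m; apply/(quot.2 _).1.
by rewrite -(chi_base_change bc) s0 chi0.
Qed.

Lemma reduction_surjective y : exists s, rho s = y.
Proof.
have [K yK] := deg_lt_exists ch' y.
apply: (span_monomials (K := [set y | exists s, rho s = y]) _ yK) => [|i m _].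
  split=> [|_ _ [s <-] [t <-]|b _ [s <-]].
  - by exists 0; rewrite rmorph0.
  - by exists (s + t); rewrite rmorphD.
  - have [x <-] := quot.1 b; exists (lb_str V x * s).
    by rewrite rmorphM (bc_str bc).
by exists (chX ch i ^+ m); rewrite rmorphXn formE.
Qed.

Lemma image_ideal (J : set (lb_ring V)) : is_ideal J -> is_ideal (rho @` J).
Proof.
move=> Ji; split=> [|_ _ [s Js <-] [t Jt <-]|y _ [s Js <-]].
- by exists 0; [apply: ideal0 | rewrite rmorph0].
- by exists (s + t); [apply: idealD | rewrite rmorphD].
- have [x <-] := reduction_surjective y.
  by exists (x * s); [apply: idealMl | rewrite rmorphM].
Qed.

(** As [rho] is surjective with kernel W, the equality of ideals in the reduction becomes two
    inclusions modulo W in the original ring. *)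
Lemma reduction_criterion (C : set (lb_ring V)) n : is_ideal C ->
  ideal_gen (rho @` C) = monomial_ideal ch' n <->
  C `<=` ideal_add (monomial_ideal ch n) W /\
  forall j, ideal_add C W (chX ch j ^+ n).
Proof.
move=> Ci; have Mi := ideal_gen_ideal (range (fun j => chX ch j ^+ n)).
have lift J s : is_ideal J -> (rho @` J) (rho s) -> ideal_add J W s.
  move=> Ji [t Jt /eqP]; rewrite eq_sym -subr_eq0 -rmorphB => /eqP/reduction_kernel Wst.
  by exists t, (s - t); split=> //; rewrite addrC subrK.
split=> [eqC|[CM XC]].
  split=> [s Cs|j]; apply: lift => //.
    have : monomial_ideal ch' n (rho s).
      by rewrite -eqC; apply: sub_ideal_gen; exists s.
    apply: (ideal_gen_min (image_ideal Mi)) => _ [j _ <-].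
    exists (chX ch j ^+ n); first by apply: sub_ideal_gen; exists j.
    by rewrite rmorphXn formE.
  have : ideal_gen (rho @` C) (chX ch' j ^+ n).
    by rewrite eqC; apply: sub_ideal_gen; exists j.
  rewrite formE -rmorphXn.
  by apply: (ideal_gen_min (image_ideal Ci)).
apply/seteqP; split.
  apply: ideal_gen_min => [|_ [s Cs <-]]; first exact: ideal_gen_ideal.
  have [x [y [Mx /reduction_kernel ry ->]]] := CM s Cs.
  rewrite rmorphD ry addr0; apply: (monomial_ideal_base_change formE Mx).
apply: ideal_gen_min => [|_ [j _ <-]]; first exact: ideal_gen_ideal.
have [x [y [Cx /reduction_kernel ry E]]] := XC j.
rewrite formE -rmorphXn E rmorphD ry addr0.
by apply: sub_ideal_gen; exists x.
Qed.

End Reduction.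

(** The function by which the comorphism of Phi_x multiplies linear forms. In a trivialisation it is
    Phi_x(X)/X, where X is the coordinate. *)
Definition multiplier (F : finFieldType) r (B : comPzRingType)
    (gamma : {rmorphism {poly F} -> B}) (E : drinfeld_module r gamma)
    (x : {poly F}) : lb_ring E :=
  \sum_(i < (r * pdeg x).+1) coef E x i.
Arguments multiplier {F r B gamma} E x.

(** * The submodule scheme property *)

Section SubmoduleScheme.
Variables (F : finFieldType) (r : nat) (B : comPzRingType).
Variables (gamma : {rmorphism {poly F} -> B}) (E : drinfeld_module r gamma).
Variables (sz : nat) (ch : charts sz E).
Local Notation q := #|F|.
Local Notation S := (lb_ring E).
Local Notation str := (lb_str E).
Local Notation coord := (@lb_coord B E).
Local Notation X := (chX ch).

Lemma phi_multiplier x f : dm_phi E x (coord f) = multiplier E x * coord f.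
Proof. exact: phi_coord. Qed.

Lemma torsion_idealE x : @torsion_ideal F r B gamma E x = torsion (multiplier E x).
Proof.
have phiE : (fun f => dm_phi E x (coord f)) = (fun f => multiplier E x * coord f).
  by apply/funext => f; rewrite phi_multiplier.
by rewrite /torsion_ideal phiE.
Qed.

Lemma frobenius_kernel_idealE d n :
  @frobenius_kernel_ideal F r B gamma E d n = monomial_ideal ch (q ^ (n * d)).
Proof.
have iterE (s : S) : iter n (fun s => s ^+ (q ^ d)) s = s ^+ (q ^ (n * d)).
  elim: n => [|m IHm]; first by rewrite mul0n expn0 expr1.
  by rewrite iterS IHm -exprM -expnD mulSn addnC.
apply/seteqP; split; apply: ideal_gen_min; try exact: ideal_gen_ideal.
  move=> _ [f _ <-]; rewrite iterE (homog_expansion (homog_coord ch f)).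
  rewrite (frobenius_sum (str \o base_hom gamma)).
  apply: (ideal_sum (ideal_gen_ideal _)) => i _; rewrite expr1 exprMn.
  apply: (idealMl (ideal_gen_ideal _)); apply: sub_ideal_gen.
  by exists i.
move=> _ [i _ <-]; rewrite -iterE; apply: sub_ideal_gen.
by exists (ch_form ch i).
Qed.

Variables (x : {poly F}) (w : B) (N1 M i0 : nat).
Hypothesis w_complete : adically_complete w.
Hypothesis beta_top : unit_top ch (N1 + M) (multiplier E x).
Hypothesis N1E : N1.+1 = (q ^ i0)%N.
Variable eps : S.
Hypothesis eps_can : canonical_idempotent ch (multiplier E x) N1 M w eps.
Local Notation I := (torsion (multiplier E x)).
Local Notation C := (component (multiplier E x) eps).

(** T' is a finite B-subalgebra of T containing the values of the torsion point z. Modulo w, eps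
    lies in the ideal of the X_j^N, so z eps lies in w T'; being idempotent, it vanishes by
    Nakayama's lemma. *)
Lemma component_vanish (T : comPzRingType) (z : {rmorphism S -> T}) (G : seq T) :
  let T' := span (fun b y => z (str b) * y) G in
  T' 1 -> (forall u v, T' u -> T' v -> T' (u * v)) -> (forall s, T' (z s)) ->
  (forall s, I s -> z s = 0) ->
  (forall j, exists2 y, T' y & z (X j ^+ N1.+1) = z (str w) * y) ->
  forall s, C s -> z s = 0.
Proof.
move=> T' T'1 T'M T'z zI zX; pose act b y := z (str b) * y.
have actP : is_action act.
  split=> *; rewrite /act ?rmorph1 ?mul1r ?rmorphM ?mulrA ?mulrDr //.
  by rewrite !rmorphD mulrDl.
have T's : is_submodule act T' := span_submodule actP G.
have [eps_idem eps_mon _ _] := eps_can.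
have eps0 : z eps = 0.
  pose J := [set s | exists2 y, T' y & z s = z (str w) * y].
  have Ji : is_ideal J.
    split=> [|s t [y Ty ys] [y' Ty' yt]|s t [y' Ty' yt]].
    - by exists 0; [exact: (submod0 T's) | rewrite rmorph0 mulr0].
    - exists (y + y'); first exact: (submodD T's).
      by rewrite rmorphD ys yt mulrDr.
    - exists (z s * y'); first exact: (T'M _ _ (T'z s)).
      by rewrite rmorphM yt mulrCA.
  have [y Ty epsy] : J eps.
    apply: (ideal_add_min Ji) (eps_mon _ (component_self _ _)) => [|_ [c ->]].
      by apply: (ideal_gen_min Ji) => _ [j _ <-]; apply: zX.
    by exists (z c) => //; rewrite rmorphM.
  have idem : z eps * z eps = z eps.
    by apply/eqP; rewrite -subr_eq0 -rmorphM -rmorphB -expr2 zI.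
  have span_eps u : T' u -> span act [seq z eps * v | v <- G] (z eps * u).
    pose K' := [set u | span act [seq z eps * v | v <- G] (z eps * u)].
    have spans := span_submodule actP [seq z eps * v | v <- G].
    have K's : is_submodule act K'.
      split=> [|u1 u2|b u1]; rewrite /K' /= ?mulr0 ?mulrDr.
      + exact: (submod0 spans).
      + exact: (submodD spans).
      + by rewrite /act mulrCA; apply: (submodZ spans).
    have GK' : {in G, forall v, K' v}.
      by move=> v vG; apply: (mem_span actP); apply: map_f.
    exact: (span_min K's GK').
  have K0 : is_submodule act [set 0].
    by split=> [//|u v -> ->|b u ->]; rewrite ?addr0 // /act mulr0.
  have := @nakayama _ _ _ actP w [seq z eps * v | v <- G] _ (complete_unit w_complete) K0.
  move=> H; suff : span act [seq z eps * v | v <- G] `<=` [set 0].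
    by move=> /(_ _ (span_eps _ T'1)) /=; rewrite mulr1.
  (* With z eps = w y, idempotence gives (z eps) v = (z eps)^2 v = w (z eps) y v. *)
  apply: H => _ /mapP[v vG ->]; exists (z eps * (y * v)).
    by apply/span_eps/T'M => //; apply: (mem_span actP).
  rewrite /= /act -{1}idem {1}epsy; apply/eqP; rewrite subr_eq0; apply/eqP; ring.
pose ker := [set s | z s = 0].
have ker_ideal : is_ideal ker.
  split=> [|s t|s t]; rewrite /ker /= ?rmorph0 ?rmorphD ?rmorphM //.
    by move=> -> ->; rewrite addr0.
  by move=> ->; rewrite mulr0.
apply: (ideal_add_min ker_ideal) => // _ [c ->].
by rewrite /ker /= rmorphM eps0 mul0r.
Qed.

End SubmoduleScheme.

Section PointsOfComponent.
Variables (F : finFieldType) (r : nat) (B : comPzRingType).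
Variables (gamma : {rmorphism {poly F} -> B}) (E : drinfeld_module r gamma).
Variables (sz : nat) (ch : charts sz E).
Local Notation q := #|F|.
Local Notation S := (lb_ring E).
Local Notation str := (lb_str E).
Local Notation coord := (@lb_coord B E).
Local Notation X := (chX ch).

Lemma homog_coef_coord x i f : homog ch (q ^ i) (coef E x i * coord f).
Proof.
have -> : (q ^ i = (q ^ i - 1) + 1)%N by rewrite subnK ?card_field_gt0.
by apply: homogM; [apply: coef_homog | apply: homog_coord].
Qed.

(** Functions of degree q^i are combinations of the X_j^(q^i), hence additive on points. Both the
    summands of beta f and the X_j^N are of this kind. *)
Lemma frobenius_additive (T : comPzRingType) (x y z : {rmorphism S -> T}) i s :
  (forall b, y (str b) = x (str b)) -> (forall b, z (str b) = x (str b)) ->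
  (forall f, z (coord f) = x (coord f) + y (coord f)) ->
  homog ch (q ^ i) s -> z s = x s + y s.
Proof.
move=> yB zB zxy s_homog; pose K := [set s | z s = x s + y s].
apply: (homog_span (K := K)) s_homog _ => [|j].
  split=> [|u v|b u]; rewrite /K /= ?rmorph0 ?addr0 // ?rmorphD.
    by move=> -> ->; rewrite addrACA.
  by rewrite !rmorphM zB yB => ->; rewrite mulrDr.
rewrite /K /= !rmorphXn /= zxy.
exact: (frobeniusD (x \o (str \o base_hom gamma))).
Qed.

Variables (x0 : {poly F}) (w : B) (N1 M i0 : nat).
Hypothesis w_complete : adically_complete w.
Hypothesis beta_top : unit_top ch (N1 + M) (multiplier E x0).
Hypothesis N1E : N1.+1 = (q ^ i0)%N.
Variable eps : S.
Hypothesis eps_can : canonical_idempotent ch (multiplier E x0) N1 M w eps.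
Local Notation I := (torsion (multiplier E x0)).
Local Notation C := (component (multiplier E x0) eps).

Lemma torsion_vanish (T : comPzRingType) (z : {rmorphism S -> T}) :
  (forall f, z (multiplier E x0 * coord f) = 0) -> forall s, I s -> z s = 0.
Proof.
move=> z0; apply: (ideal_gen_min (J := z @^-1` [set 0])) => [|_ [f _ <-]].
  apply: preimage_ideal; split=> [//|u v -> ->|u v ->].
    by rewrite /= addr0.
  by rewrite /= mulr0.
exact: z0.
Qed.

Let generators : seq S := [seq X p.1 ^+ p.2 | p : 'I_sz * 'I_((N1 + M).+1)].

Lemma point_span (T : comPzRingType) (x : {rmorphism S -> T}) s :
  (forall s, I s -> x s = 0) ->
  span (fun b y => x (str b) * y) [seq x g | g <- generators] (x s).
Proof.
move=> xI; have [y yD /xI/eqP] := torsion_reducible beta_top s.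
rewrite rmorphB subr_eq0 => /eqP ->.
have actP : is_action (fun b y => x (str b) * y).
  split=> *; rewrite ?rmorph1 ?mul1r ?rmorphM ?mulrA ?mulrDr //.
  by rewrite !rmorphD mulrDl.
have Gs := span_submodule actP [seq x g | g <- generators].
pose K := [set s | span (fun b y => x (str b) * y) [seq x g | g <- generators] (x s)].
apply: (span_monomials (K := K) _ yD) => [|i m mD].
  split=> [|u v|b u]; rewrite /K /= ?rmorph0 ?rmorphD ?rmorphM.
  - exact: (submod0 Gs).
  - exact: (submodD Gs).
  - exact: (submodZ Gs).
apply: (mem_span actP); apply: map_f; rewrite /generators.
by apply/mapP; exists (i, Ordinal mD) => //; rewrite mem_enum inE.
Qed.

Lemma component_monomial (T : comPzRingType) (x : {rmorphism S -> T}) :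
  (forall s, C s -> x s = 0) ->
  forall j, exists s, x (X j ^+ N1.+1) = x (str w) * x s.
Proof.
move=> xC j; have [_ _ epsX _] := eps_can.
have [c [_ [Cc [s ->] ->]]] := epsX j; exists s.
by rewrite rmorphD (xC _ Cc) add0r rmorphM.
Qed.

Lemma component_zero (T : comPzRingType) (z : {rmorphism S -> T}) :
  (forall f, z (coord f) = 0) -> forall s, C s -> z s = 0.
Proof.
move=> z0; pose act b y := z (str b) * y.
have spanE u : span act [:: 1] u <-> exists b, u = z (str b).
  split=> [[b [_ [-> ->]]]|[b ->]]; exists b; rewrite /act ?mulr1 ?addr0 //.
  by exists 0; rewrite addr0.
have zX j m : (0 < m)%N -> z (X j ^+ m) = 0.
  by move=> m_gt0; rewrite rmorphXn /= z0 expr0n gtn_eqF.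
(* The zero section takes all its values in the image of B, which is spanned by 1. *)
apply: (component_vanish w_complete eps_can (G := [:: 1])).
- by apply/spanE; exists 1; rewrite !rmorph1.
- move=> u v /spanE[b ->] /spanE[c ->]; apply/spanE; exists (b * c).
  by rewrite !rmorphM.
- move=> s; apply/spanE; have [K sK] := deg_lt_exists ch s.
  apply: (span_monomials (K := [set s | exists b, z s = z (str b)]) _ sK).
    split=> [|u v [b zu] [c zv]|b u [c zu]].
    + by exists 0; rewrite !rmorph0.
    + by exists (b + c); rewrite !rmorphD zu zv.
    + by exists (b * c); rewrite !rmorphM zu.
  move=> i [|m] _; first by exists 1; rewrite expr0 !rmorph1.
  by exists 0; rewrite zX ?rmorph0.
- by apply: torsion_vanish => f; rewrite rmorphM z0 mulr0.
- move=> j; exists 0; last by rewrite zX ?mulr0.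
  by apply/spanE; exists 0; rewrite !rmorph0.
Qed.

Lemma component_phi (T : comPzRingType) (x : {rmorphism S -> T}) y :
  (forall s, C s -> x s = 0) -> forall s, C s -> x (dm_phi E y s) = 0.
Proof.
move=> xC; have xI s : I s -> x s = 0 by move=> /component_torsion-/(_ eps)/xC.
pose z : {rmorphism S -> T} := x \o dm_phi E y.
have zB b : z (str b) = x (str b) by rewrite /= dm_phi_str.
pose act b y := x (str b) * y.
have actE : (fun b y => z (str b) * y) = act by apply/funext => b; rewrite zB.
have actP : is_action act.
  split=> *; rewrite /act ?rmorph1 ?mul1r ?rmorphM ?mulrA ?mulrDr //.
  by rewrite !rmorphD mulrDl.
pose G := [seq x g | g <- generators].
have inG s : span act G (x s) := point_span s xI.
have spanE u : span act G u -> exists s, u = x s.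
  apply: (span_min (K := [set u | exists s, u = x s])) => [|_ /mapP[s _ ->]].
    split=> [|_ _ [s ->] [t ->]|b _ [s ->]].
    - by exists 0; rewrite rmorph0.
    - by exists (s + t); rewrite rmorphD.
    - by exists (str b * s); rewrite rmorphM.
  by exists s.
have := component_vanish w_complete eps_can (z := z) (G := G).
rewrite actE; apply.
- by rewrite -(rmorph1 x).
- by move=> _ _ /spanE[s ->] /spanE[t ->]; rewrite -rmorphM.
- by move=> s; apply: inG.
(* Phi_y preserves the torsion because it commutes with Phi_x0. *)
- apply: torsion_vanish => f /=; rewrite -phi_multiplier -dm_phiM mulrC dm_phiM.
  rewrite phi_multiplier rmorphM phi_multiplier rmorphM.
  by rewrite [x (_ * coord f)]xI ?mulr0 //; apply: beta_coord_torsion.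
- move=> j; have [s xs] := component_monomial xC j.
  exists (x (s * multiplier E y ^+ N1.+1)) => //.
  have -> : z (X j ^+ N1.+1) = x (multiplier E y ^+ N1.+1 * X j ^+ N1.+1).
    by rewrite -exprMn -phi_multiplier !rmorphXn.
  by rewrite zB !rmorphM xs; ring.
Qed.

Lemma component_add (T : comPzRingType) (x y z : {rmorphism S -> T}) :
  (forall b, y (str b) = x (str b)) -> (forall b, z (str b) = x (str b)) ->
  (forall f, z (coord f) = x (coord f) + y (coord f)) ->
  (forall s, C s -> x s = 0) -> (forall s, C s -> y s = 0) ->
  forall s, C s -> z s = 0.
Proof.
move=> yB zB zxy xC yC.
have xI s : I s -> x s = 0 by move=> /component_torsion-/(_ eps)/xC.
have yI s : I s -> y s = 0 by move=> /component_torsion-/(_ eps)/yC.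
pose act b u := x (str b) * u.
have actEz : (fun b u => z (str b) * u) = act by apply/funext => b; rewrite zB.
have actEy : (fun b u => y (str b) * u) = act by apply/funext => b; rewrite yB.
have actP : is_action act.
  split=> *; rewrite /act ?rmorph1 ?mul1r ?rmorphM ?mulrA ?mulrDr //.
  by rewrite !rmorphD mulrDl.
(* The products of values of x and y span the B-subalgebra that they generate, and it contains the
   values of z. *)
pose G := [seq u * v | u <- [seq x g | g <- generators], v <- [seq y g | g <- generators]].
have Gs := span_submodule actP G.
have inG s t : span act G (x s * y t).
  have xs : span act [seq x g | g <- generators] (x s) := point_span s xI.
  have := point_span t yI; rewrite actEy => yt.
  pose K1 := [set u | span act G (u * y t)].
  apply: (span_min (K := K1)) xs => [|u ux].
    split=> [|u v|b u]; rewrite /K1 /= ?mul0r ?mulrDl /act -?mulrA.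
    - exact: (submod0 Gs).
    - exact: (submodD Gs).
    - exact: (submodZ Gs).
  pose K2 := [set v | span act G (u * v)].
  apply: (span_min (K := K2)) yt => [|v vy].
    split=> [|v v'|b v]; rewrite /K2 /= ?mulr0 ?mulrDr /act.
    - exact: (submod0 Gs).
    - exact: (submodD Gs).
    - rewrite mulrCA; exact: (submodZ Gs).
  by apply: (mem_span actP); apply/allpairsP; exists (u, v).
have GM u v : span act G u -> span act G v -> span act G (u * v).
  move=> Gu Gv; pose K1 := [set u | span act G (u * v)].
  apply: (span_min (K := K1)) Gu => [|_ /allpairsP[[_ _] /= [/mapP[s _ ->] /mapP[t _ ->] ->]]].
    split=> [|u1 u2|b u1]; rewrite /K1 /= ?mul0r ?mulrDl /act -?mulrA.
    - exact: (submod0 Gs).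
    - exact: (submodD Gs).
    - exact: (submodZ Gs).
  pose K2 := [set v | span act G (x s * y t * v)].
  apply: (span_min (K := K2)) Gv => [|_ /allpairsP[[_ _] /= [/mapP[s' _ ->] /mapP[t' _ ->] ->]]].
    split=> [|v1 v2|b v1]; rewrite /K2 /= ?mulr0 ?mulrDr /act.
    - exact: (submod0 Gs).
    - exact: (submodD Gs).
    - rewrite mulrCA; exact: (submodZ Gs).
  by rewrite /K2 /= mulrACA -!rmorphM.
have xG s : span act G (x s) by rewrite -(mulr1 (x s)) -(rmorph1 y).
have yG s : span act G (y s) by rewrite -(mul1r (y s)) -(rmorph1 x).
have G1 : span act G 1 by rewrite -(rmorph1 x).
have := component_vanish w_complete eps_can (z := z) (G := G).
rewrite actEz; apply => //.
- move=> s; have [K sK] := deg_lt_exists ch s.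
  apply: (span_monomials (K := [set s | span act G (z s)]) _ sK).
    split=> [|u v|b u] /=; rewrite ?rmorph0 ?rmorphD ?rmorphM ?zB.
    - exact: (submod0 Gs).
    - exact: (submodD Gs).
    - exact: (submodZ Gs).
  move=> i m _ /=; elim: m => [|m IHm]; first by rewrite expr0 rmorph1.
  rewrite exprS rmorphM; apply: GM => //; rewrite zxy.
  exact: (submodD Gs).
- apply: torsion_vanish => f; rewrite /multiplier mulr_suml rmorph_sum.
  under eq_bigr => i _ do rewrite (frobenius_additive yB zB zxy (@homog_coef_coord x0 i f)).
  rewrite big_split -!rmorph_sum -mulr_suml -/(multiplier E x0) /=.
  by rewrite xI ?yI ?addr0 //; apply: beta_coord_torsion.
- move=> j; have [s xs] := component_monomial xC j.
  have [t yt] := component_monomial yC j.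
  exists (x s + y t); first exact: (submodD Gs).
  have Xh : homog ch (q ^ i0) (X j ^+ N1.+1) by rewrite -N1E; apply: homog_monomial.
  by rewrite (frobenius_additive yB zB zxy Xh) xs yt yB zB mulrDr.
Qed.

Lemma component_submodule_scheme : @is_submodule_scheme F r B gamma E C.
Proof.
move=> T on_J; split.
- exact: component_zero.
- by move=> x y z yB zB zxy xC yC; apply: (component_add yB zB zxy).
- by move=> y x xC; apply: component_phi.
Qed.

Hypothesis M_gt0 : (0 < M)%N.

Lemma component_flf : @is_flf_submodule_of_torsion F r B gamma E x0 C.
Proof.
split; [exact: component_ideal| |exact: (component_locally_free M_gt0 beta_top w_complete)|].
  by rewrite torsion_idealE; apply: component_torsion.
exact: component_submodule_scheme.
Qed.

End PointsOfComponent.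

(** * Uniqueness, and existence in the ordinary case *)

Section Uniqueness.
Variables (B : comPzRingType) (V : line_bundle B) (sz : nat) (ch : charts sz V).
Local Notation S := (lb_ring V).
Local Notation str := (lb_str V).
Local Notation X := (chX ch).
Local Notation sact := (fun b s => str b * s).
Variables (beta : S) (N1 M : nat) (w : B) (eps : S).
Hypothesis w_complete : adically_complete w.
Hypothesis beta_top : unit_top ch (N1 + M) beta.
Hypothesis eps_can : canonical_idempotent ch beta N1 M w eps.
Local Notation I := (torsion beta).
Local Notation W := (principal (str w)).
Local Notation C := (component beta eps).

(** Both ideals agree modulo w with the ideal of the X_j^N. In S/C1 the idempotent eps is divisible
    by w, hence zero, so C lies in C1. Conversely C1 is a direct summand of S contained in C + W,
    and Nakayama's lemma through the projection gives equality. *)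
Lemma component_unique (C1 : set S) ranks : is_ideal C1 -> I `<=` C1 ->
  locally_free sact C1 ranks ->
  C1 `<=` ideal_add (monomial_ideal ch N1.+1) W ->
  (forall j, ideal_add C1 W (X j ^+ N1.+1)) -> C1 = C.
Proof.
move=> C1i IC1 C1_free C1M XC1.
have [eps_idem eps_mon epsX _] := eps_can.
have Wi := principal_ideal (str w); have Ci := component_ideal beta eps.
have Ii := torsion_is_ideal beta.
have C1Wi := ideal_add_ideal C1i Wi; have CWi := ideal_add_ideal Ci Wi.
have nakayama := torsion_nakayama beta_top w_complete.
have eps_C1 : C1 eps.
  have [c [_ [C1c [t ->] epsE]]] : ideal_add C1 W eps.
    apply: (ideal_add_min C1Wi) (eps_mon _ (component_self _ _)) => [|s]; last exact: (ideal_addr C1i).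
    by apply: (ideal_gen_min C1Wi) => _ [j _ <-]; apply: XC1.
  pose K := [set s | C1 (eps * s)].
  suff : K 1 by rewrite /K /= mulr1.
  apply: nakayama.
  - split=> [|s s'|b s]; rewrite /K /= ?mulr0 ?mulrDr.
    + exact: (ideal0 C1i).
    + exact: (idealD C1i).
    + by rewrite mulrCA; apply: (idealMl C1i).
  - by move=> s Is; apply: (idealMl C1i); apply: IC1.
  - move=> s; exists ((1 - eps) * s + c * s).
      rewrite /K /=.
      have -> : eps * ((1 - eps) * s + c * s) = - (eps ^+ 2 - eps) * s + eps * s * c by ring.
      apply: (idealD C1i); last exact: (idealMl C1i).
      by apply: (idealMr C1i); apply: (idealN C1i); apply: IC1.
    have -> : s - ((1 - eps) * s + c * s) = (eps - c) * s by ring.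
    by apply: (idealMr Wi); rewrite epsE addrAC subrr add0r; apply: principal_mul.
have CC1 : C `<=` C1.
  by apply: (ideal_add_min C1i) => // _ [c ->]; apply: (idealMr C1i).
apply/seteqP; split=> // s C1s.
(* S / C1 is projective, so C1 is a direct summand of S; p is a projection.   *)
have [T [g [psi [psiL psiC1 psiP]]]] :=
  locally_free_dual_basis (str_action V) (ideal_submodule C1i) C1_free.
pose p s := s - \sum_t str (psi t s) * g t.
have pC1 u : C1 (p u) by exact: psiP.
have p_id u : C1 u -> p u = u.
  by move=> C1u; rewrite /p big1 ?subr0 // => t _; rewrite psiC1 // rmorph0 mul0r.
have pL b u v : p (str b * u + v) = str b * p u + p v.
  rewrite /p mulrBr mulr_sumr addrACA -opprD -big_split; congr (_ - _).
  by apply: eq_bigr => t _; rewrite psiL rmorphD rmorphM /= mulrDl mulrA.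
have p0 : p 0 = 0 by apply: p_id; apply: (ideal0 C1i).
have pD u v : p (u + v) = p u + p v.
  by have := pL 1 u v; rewrite rmorph1 !mul1r.
have pZ b u : p (str b * u) = str b * p u by have := pL b u 0; rewrite p0 !addr0.
pose K := [set u | C (p u)].
suff : K s by rewrite /K /= p_id.
apply: nakayama.
- split=> [|u v|b u]; rewrite /K /= ?p0 ?pD ?pZ.
  + exact: (ideal0 Ci).
  + exact: (idealD Ci).
  + exact: (idealMl Ci).
- by move=> u Iu; rewrite /K /= p_id; [apply: component_torsion | apply: IC1].
- move=> u; have : ideal_add C W (p u).
    apply: (ideal_add_min CWi) (C1M _ (pC1 u)) => [|v]; last exact: (ideal_addr Ci).
    by apply: (ideal_gen_min CWi) => _ [j _ <-]; apply: epsX.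
  case=> c [v [Cc Wv puE]]; exists (u - p u + c).
    have pu0 : p (u - p u) = 0.
      by rewrite -[- p u]mulN1r -(rmorph1 str) -rmorphN pD pZ (p_id (p u)) // rmorphN1 mulN1r subrr.
    by rewrite /K /= pD pu0 add0r p_id //; apply: CC1.
  have -> : u - (u - p u + c) = p u - c by ring.
  by rewrite puE addrAC subrr add0r.
Qed.

End Uniqueness.

Section OrdinaryIdempotent.
Variables (B : comPzRingType) (V : line_bundle B) (sz : nat) (ch : charts sz V).
Local Notation S := (lb_ring V).
Local Notation str := (lb_str V).
Local Notation coord := (@lb_coord B V).
Local Notation X := (chX ch).
Local Notation a := (chA ch).
Local Notation e := (ch_vec ch).
Variables (N1 M : nat) (w : B).
Local Notation W := (principal (str w)).
Local Notation Wi := (principal_ideal (str w)).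
Hypothesis w_complete : adically_complete w.

Definition generates_mod n s := forall j, exists b, W (X j ^+ n - str b * s).

Lemma homog_divide n m u s : generates_mod n u -> homog ch (n + m) s ->
  exists2 h, homog ch m h & W (s - u * h).
Proof.
move=> u_gen s_homog.
pose K := [set s | exists2 h, homog ch m h & W (s - u * h)].
apply: (homog_span (K := K)) s_homog _ => [|j].
  split=> [|s1 s2 [h1 h1m W1] [h2 h2m W2]|b s1 [h1 h1m W1]].
  - by exists 0; [apply: homog0 | rewrite mulr0 subrr; apply: (ideal0 Wi)].
  - exists (h1 + h2); first exact: homogD.
    by rewrite mulrDr opprD addrACA; apply: (idealD Wi).
  - exists (str b * h1); first exact: homogZ.
    by rewrite mulrCA -mulrBr; apply: (idealMl Wi).
have [b Wb] := u_gen j; exists (str b * X j ^+ m); first exact/homogZ/homog_monomial.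
have -> : X j ^+ (n + m) - u * (str b * X j ^+ m) = (X j ^+ n - str b * u) * X j ^+ m.
  by rewrite exprD; ring.
exact: (idealMr Wi).
Qed.

Lemma homog_monomial_ideal n m s : (n <= m)%N -> homog ch m s -> monomial_ideal ch n s.
Proof.
move=> nm s_homog; have Mi := ideal_gen_ideal (range (fun j => X j ^+ n)).
apply: (homog_span (K := monomial_ideal ch n)) s_homog _ => [|j].
  exact: ideal_submodule.
rewrite -(subnK nm) exprD; apply: (idealMl Mi); apply: sub_ideal_gen.
by exists j.
Qed.

(** A factor of a nowhere vanishing section is nowhere vanishing: on D(a i), the coefficient of top
    is modulo w the product of those of u and h. *)
Lemma quotient_generates (u h top : S) : homog ch N1 u -> homog ch M h ->
  homog ch (N1 + M) top -> generates ch (N1 + M) top -> W (top - u * h) ->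
  generates_mod M h.
Proof.
move=> u_homog h_homog top_homog top_gen Wtop j.
pose J := [set b | exists b', W (str b * X j ^+ M - str b' * h)].
have Ji : is_ideal J.
  split=> [|x y [b Wx] [c Wy]|x y [c Wy]].
  - by exists 0; rewrite rmorph0 !mul0r subrr; apply: (ideal0 Wi).
  - exists (b + c); rewrite !rmorphD !mulrDl opprD addrACA.
    exact: (idealD Wi).
  - exists (x * c); rewrite !rmorphM -!mulrA -mulrBr.
    exact: (idealMl Wi).
suff [b] : J 1 by rewrite rmorph1 mul1r => Wb; exists b.
apply: (chart_local_to_global (ch := ch) Ji) => i; exists ((N1 + M) + M)%N.
have [b bX] := top_gen i.
set l := ch_form ch j (e i); set chu := chi (e i) u N1.
exists (l ^+ M * b * chu * a i ^+ M); rewrite exprD.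
have lead : a i ^+ (N1 + M) = b * chi (e i) top (N1 + M).
  by rewrite -chiZ -bX chi_monomial eqxx.
have chi_uh : chi (e i) (u * h) (N1 + M) = chu * chi (e i) h M.
  exact: (chi_mul_homog _ _ (h_homog i)).
have := chi_principal (e i) (N1 + M) Wtop; rewrite chiB chi_uh => -[c cE].
have -> : str (a i ^+ (N1 + M) * a i ^+ M) * X j ^+ M
    = str (l ^+ M * b * chi (e i) top (N1 + M)) * X i ^+ M.
  rewrite rmorphM -mulrA monomial_chart lead !rmorphM; ring.
have -> : str (l ^+ M * b * chu * a i ^+ M) * h
    = str (l ^+ M * b * (chu * chi (e i) h M)) * X i ^+ M.
  rewrite rmorphM -mulrA (homog_chart i h_homog) !rmorphM; ring.
rewrite -mulrBl -rmorphB -mulrBr cE mulrCA rmorphM -mulrA.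
exact: principal_mul.
Qed.

Variables (beta u eta : S).
Hypothesis beta_top : unit_top ch (N1 + M) beta.
Hypothesis u_homog : homog ch N1 u.
Hypothesis u_gen : generates_mod N1 u.
Hypothesis beta_u : W (beta - u * (1 - eta)).
Hypothesis eta_mon : monomial_ideal ch N1.+1 eta.
Hypothesis eta_top : exists2 h, generates_mod M h & deg_lt ch M (1 - eta - h).
Local Notation I := (torsion beta).
Local Notation Q := (ideal_add I W).

(** Since u divides X_j^(N-1) modulo w, X_j^N (1 - eta) is there a multiple of beta X_j. As eta lies
    in the ideal of the X_j^N, it is idempotent modulo I + W and can be lifted. The invertible top
    part of 1 - eta, of degree M, bounds the degrees on the complement. *)
Lemma canonical_idempotent_exists :
  exists eps, canonical_idempotent ch beta N1 M w eps.
Proof.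
have Ii := torsion_is_ideal beta.
have Qi : is_ideal Q := ideal_add_ideal Ii Wi.
have QI s : I s -> Q s by exact: (ideal_addl Wi).
have QW s : W s -> Q s by exact: (ideal_addr Ii).
have XQ j : Q (X j ^+ N1.+1 * (1 - eta)).
  have [b Wb] := u_gen j.
  have -> : X j ^+ N1.+1 * (1 - eta) = (X j ^+ N1 - str b * u) * (X j * (1 - eta))
    - str b * (X j * (beta - u * (1 - eta))) + str b * (beta * X j).
    by rewrite exprSr; ring.
  apply: (idealD Qi); last first.
    by apply: (idealMl Qi); apply: QI; apply: beta_coord_torsion.
  apply: QW; apply: (idealB Wi); first exact: (idealMr Wi).
  by do 2!apply: (idealMl Wi).
have eta_idem : Q (eta ^+ 2 - eta).
  pose J := [set s | Q (s * (1 - eta))].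
  have Ji : is_ideal J.
    split=> [|s t|s t]; rewrite /J /= ?mul0r ?mulrDl -?mulrA.
    - exact: (ideal0 Qi).
    - exact: (idealD Qi).
    - exact: (idealMl Qi).
  have -> : eta ^+ 2 - eta = - (eta * (1 - eta)) by ring.
  apply: (idealN Qi); apply: (ideal_gen_min Ji) eta_mon => _ [j _ <-].
  exact: XQ.
have [|eps eps_idem] := idempotent_lift beta_top w_complete (h := eta).
  by rewrite expr1.
rewrite expr1 => Qeps; exists eps.
have Mi := ideal_gen_ideal (range (fun j => X j ^+ N1.+1)).
have MWi := ideal_add_ideal Mi Wi.
have Ci := component_ideal beta eps; have CWi := ideal_add_ideal Ci Wi.
have Ci' := component_ideal beta (1 - eps); have CWi' := ideal_add_ideal Ci' Wi.
have QC s eps' : Q s -> ideal_add (component beta eps') W s.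
  move=> [x [y [Ix Wy ->]]]; exists x, y; split=> //.
  exact: component_torsion.
have QM : Q `<=` ideal_add (monomial_ideal ch N1.+1) W.
  apply: (ideal_add_min MWi) => [|s]; last exact: (ideal_addr Mi).
  apply: (ideal_gen_min MWi) => _ [f _ <-].
  have -> : beta * coord f = (beta - u * (1 - eta)) * coord f + (u * coord f) * (1 - eta).
    by ring.
  apply: (idealD MWi).
    by apply: (ideal_addr Mi); apply: (idealMr Wi).
  apply: (ideal_addl Wi); apply: (idealMr Mi).
  apply: (homog_monomial_ideal (leqnn _)); rewrite -addn1.
  by apply: homogM => //; apply: homog_coord.
split=> //.
- apply: (ideal_add_min MWi) => [_ [c ->]|s /QI]; last exact: QM.
  apply: (idealMr MWi); rewrite -(subrK eta eps); apply: (idealD MWi).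
    exact: QM.
  exact: (ideal_addl Wi).
- move=> j.
  have -> : X j ^+ N1.+1 = X j ^+ N1.+1 * (1 - eta) - X j ^+ N1.+1 * (eps - eta)
    + X j ^+ N1.+1 * eps by ring.
  apply: (idealD CWi); last first.
    by apply: (ideal_addl Wi); apply: (idealMl Ci); apply: component_self.
  by apply: (idealB CWi); apply: QC => //; apply: (idealMl Qi).
- move=> j; have [h h_gen low] := eta_top; have [b Wb] := h_gen j.
  exists (- (str b * (1 - eta - h))); first exact/deg_ltN/deg_ltZ.
  have -> : X j ^+ M - - (str b * (1 - eta - h)) = (X j ^+ M - str b * h)
    + str b * (eps - eta) + str b * (1 - eps) by ring.
  apply: (idealD CWi'); last first.
    by apply: (ideal_addl Wi); apply: (idealMl Ci'); apply: component_self.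
  apply: (idealD CWi'); first exact: (ideal_addr Ci').
  by apply: QC; apply: (idealMl Qi).
Qed.

End OrdinaryIdempotent.

(** * Coefficients of an ordinary Drinfeld module modulo [wp] *)

Section OrdinaryReduction.
Variables (F : finFieldType) (B : comPzRingType).
Variables (gamma : {rmorphism {poly F} -> B}) (E : drinfeld_module 2 gamma).
Variables (sz : nat) (ch : charts sz E).
Variable wp : {poly F}.
Hypotheses (wp_monic : wp \is monic) (wp_irr : irreducible_poly wp).
Local Notation q := #|F|.
Local Notation S := (lb_ring E).
Local Notation str := (lb_str E).
Local Notation coord := (@lb_coord B E).
Local Notation X := (chX ch).
Local Notation w := (gamma wp).
Local Notation W := (principal (str w)).
Local Notation Wi := (principal_ideal (str w)).
Local Notation d := (pdeg wp).

Lemma irreducible_pdeg_gt0 : (0 < d)%N.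
Proof. by case: wp_irr; rewrite /pdeg; case: size => [|[]]. Qed.

Lemma pdegX n : pdeg (wp ^+ n) = (n * d)%N.
Proof. by rewrite /pdeg size_exp mulnC. Qed.

Lemma wpX_neq0 n : wp ^+ n != 0.
Proof. exact/expf_neq0/monic_neq0. Qed.

Lemma ideal_exp_gt0 (J : set S) s k : is_ideal J -> (0 < k)%N -> J s -> J (s ^+ k).
Proof. by case: k => // k Ji _ Js; rewrite exprS; apply: (idealMr Ji). Qed.

(* Phi_wp and Phi_t commute, so the first coefficient alpha_h of Phi_wp that  *)
(* is nonzero mod wp satisfies alpha_h theta^(q^h) = theta alpha_h, while     *)
(* theta^(q^h) - theta is invertible mod wp for 0 < h < d.                    *)
Lemma coef_wp_small h : (h < d)%N -> W (coef E wp h).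
Proof.
elim/ltn_ind: h => h IHh hd; have wp0 := monic_neq0 wp_monic.
have [->|h_gt0] := posnP h.
  by rewrite coef0 //; exists 1; rewrite mulr1.
have small k : (k < h)%N -> W (coef E wp k) by move=> kh; apply: IHh => //; lia.
have X0 : ('X : {poly F}) != 0 by rewrite polyX_eq0.
have H1 : W (coef E (wp * 'X) h - coef E wp h * coef E 'X 0 ^+ (q ^ h)).
  have := @coefM_cong _ _ _ _ E _ ch W wp 'X h 0 Wi; rewrite addn0; apply.
  by move=> i k ik ne; apply: (idealMr Wi); apply: small; lia.
have H2 : W (coef E (wp * 'X) h - coef E 'X 0 * coef E wp h).
  have := @coefM_cong _ _ _ _ E _ ch W 'X wp 0 h Wi.
  rewrite expn0 expr1 add0n mulrC; apply=> i k ik ne; apply: (idealMl Wi).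
  by apply: (ideal_exp_gt0 Wi (card_field_gt0 _ _)); apply: small; lia.
have H3 : W (str (gamma ('X^(q ^ h) - 'X)) * coef E wp h).
  have -> : str (gamma ('X^(q ^ h) - 'X)) * coef E wp h =
     (coef E (wp * 'X) h - coef E 'X 0 * coef E wp h)
     - (coef E (wp * 'X) h - coef E wp h * coef E 'X 0 ^+ (q ^ h)).
    by rewrite coef0 // !rmorphB !rmorphXn; ring.
  exact: (idealB Wi).
have cop : coprimep wp ('X^(q ^ h) - 'X).
  by apply: coprimep_artin_schreier => //; rewrite h_gt0.
have [[u v] /= uv1] := Bezout_eq1_coprimepP _ _ cop.
have -> : coef E wp h = str (gamma u) * coef E wp h * str w
   + str (gamma v) * (str (gamma ('X^(q ^ h) - 'X)) * coef E wp h).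
  rewrite -[LHS]mul1r -(rmorph1 str) -(rmorph1 gamma) -uv1 !rmorphD !rmorphM; ring.
apply: (idealD Wi); last exact: (idealMl Wi).
by rewrite mulrC; apply: principal_mul.
Qed.

Lemma coef_wpX_small n h : (h < n * d)%N -> W (coef E (wp ^+ n) h).
Proof.
elim: n h => [//|n IHn] h hnd.
pose K := (2 * pdeg wp + 2 * pdeg (wp ^+ n)).+1.
rewrite exprS (@coefM _ _ _ _ E _ ch _ _ _ K) ?ltnS ?leq_addr ?leq_addl //.
apply: (ideal_sum Wi) => -[i k] /= /eqP ik.
have [id|di] := ltnP i d.
  by apply: (idealMr Wi); apply: coef_wp_small.
apply: (idealMl Wi); apply: (ideal_exp_gt0 Wi (card_field_gt0 _ _)).
by apply: IHn; rewrite mulSn in hnd; lia.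
Qed.

Lemma principal_exp_cong s t k : W (s - t) -> W (s ^+ k - t ^+ k).
Proof.
move=> st; elim: k => [|k IHk]; first by rewrite !expr0 subrr; apply: (ideal0 Wi).
by rewrite !exprS; apply: (idealM_cong Wi).
Qed.

Hypothesis ord : generates_mod ch w (q ^ d - 1) (coef E wp d).

(** Modulo w, the lowest coefficient of a product of twisted polynomials is the product of the
    lowest ones, up to Frobenius powers. *)
Lemma coef_wpX_generates n :
  generates_mod ch w (q ^ (n * d) - 1) (coef E (wp ^+ n) (n * d)).
Proof.
elim: n => [|n IHn] j.
  exists 1; rewrite expr0 mul0n expn0 subnn expr0 coef0 ?oner_neq0 // !rmorph1.
  by rewrite mulr1 subrr; apply: (ideal0 Wi).
have [b1 W1] := ord j; have [b2 W2] := IHn j.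
exists (b1 * b2 ^+ (q ^ d)); rewrite exprS mulSn.
have Hc : W (coef E (wp * wp ^+ n) (d + n * d)
    - coef E wp d * coef E (wp ^+ n) (n * d) ^+ (q ^ d)).
  apply: (coefM_cong ch) => [|i k ik ne]; first exact: Wi.
  have [id|di] := ltnP i d.
    by apply: (idealMr Wi); apply: coef_wp_small.
  apply: (idealMl Wi); apply: (ideal_exp_gt0 Wi (card_field_gt0 _ _)).
  by apply: coef_wpX_small; move/eqP: ne; lia.
have -> : (q ^ (d + n * d) - 1 = (q ^ d - 1) + (q ^ (n * d) - 1) * q ^ d)%N.
  rewrite expnD; have := card_field_gt0 F d; have := card_field_gt0 F (n * d).
  move: (q ^ d)%N (q ^ (n * d))%N => u v; nia.
rewrite exprD exprM.
have H12 := idealM_cong Wi W1 (principal_exp_cong (q ^ d) W2).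
have := idealB Wi H12 (idealMl Wi (str (b1 * b2 ^+ (q ^ d))) Hc).
by congr (W _); rewrite exprMn !rmorphM !rmorphXn; ring.
Qed.

Variable n : nat.
Hypothesis n_gt0 : (0 < n)%N.
Local Notation N1 := (q ^ (n * d) - 1)%N.
Local Notation M := (q ^ (2 * (n * d)) - q ^ (n * d))%N.
Local Notation c := (coef E (wp ^+ n)).

Lemma multiplier_top : unit_top ch (N1 + M) (multiplier E (wp ^+ n)).
Proof.
exists (c (2 * (n * d))); rewrite degree_split; split.
- exact: coef_homog.
- apply: nowhere_vanishing_generates; first exact: coef_homog.
  rewrite -pdegX coefE ?wpX_neq0 //; apply: dm_coef_lead; exact: wpX_neq0.
- rewrite /multiplier pdegX big_ord_recr /= addrK; apply: deg_lt_sum => i _.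
  apply: homog_deg_lt; last exact: coef_homog.
  have := ltn_ord i; have := card_field_gt0 F i.
  rewrite -(expn_card_ltn F i).
  by move: (q ^ i)%N (q ^ (2 * (n * d)))%N => u v; lia.
Qed.

Hypothesis w_complete : adically_complete w.

Lemma ordinary_idempotent :
  exists eps, canonical_idempotent ch (multiplier E (wp ^+ n)) N1 M w eps.
Proof.
have u_gen := coef_wpX_generates n.
set nd := (n * d)%N in u_gen *; set u := c nd in u_gen.
have nd_gt0 : (0 < nd)%N by rewrite muln_gt0 n_gt0 irreducible_pdeg_gt0.
(* h i is the quotient c i / u modulo w; the implication lets [choice] range over all i. *)
have quot i : exists h, (nd < i)%N ->
    homog ch (q ^ i - q ^ nd) h /\ W (c i - u * h).
  have [ndi|//] := ltnP nd i; last by exists 0.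
  have iE : (q ^ i - 1 = (q ^ nd - 1) + (q ^ i - q ^ nd))%N.
    have : (q ^ nd <= q ^ i)%N by rewrite expn_card_leq ltnW.
    have := card_field_gt0 F nd.
    by move: (q ^ i)%N (q ^ nd)%N => x y; lia.
  have ci_homog : homog ch (q ^ i - 1) (c i) by exact: coef_homog.
  rewrite iE in ci_homog.
  by have [h] := homog_divide u_gen ci_homog; exists h.
have [h hP] := choice quot.
pose eta := - \sum_(i < (2 * nd).+1 | (nd < i)%N) h i.
have nd_lt : (nd < (2 * nd).+1)%N by lia.
apply: (@canonical_idempotent_exists _ _ _ ch N1 M w w_complete _ u eta).
- exact: multiplier_top.
- exact: coef_homog.
- exact: u_gen.
- rewrite /eta opprK mulrDr mulr1 mulr_sumr /multiplier pdegX -/nd.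
  rewrite (bigD1 (Ordinal nd_lt)) //= -/u opprD addrACA subrr add0r.
  rewrite [X in _ - X]big_mkcond [X in _ - X](bigD1 (Ordinal nd_lt)) //= ltnn add0r -sumrB.
  apply: (ideal_sum Wi) => i ne.
  have {}ne : (i : nat) <> nd by move=> H; case/eqP: ne; apply: val_inj.
  have [ndi|ind] := ltnP nd i; first by case: (hP _ ndi).
  by rewrite subr0; apply: coef_wpX_small; rewrite -/nd; lia.
- apply: (idealN (ideal_gen_ideal _)); apply: (ideal_sum (ideal_gen_ideal _)) => i ndi.
  have [h_homog _] := hP _ ndi; apply: (homog_monomial_ideal _ h_homog).
  rewrite rank_order -/nd.
  (* For i > nd, q^i - q^nd is at least (q - 1) q^nd, hence at least N. *)
  have : (q ^ nd.+1 <= q ^ i)%N by rewrite expn_card_leq.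
  have := finNzRing_gt1 F; rewrite expnS.
  move: (q ^ nd)%N (q ^ i)%N => x y; move: #|F| => q0; nia.
- have top_lt : (nd < 2 * nd)%N by lia.
  have [top_homog Wtop] := hP _ top_lt.
  exists (h (2 * nd)%N).
    have [top [t_homog t_gen _]] := multiplier_top.
    apply: (quotient_generates (u := u) (top := c (2 * nd))) => //.
    + exact: coef_homog.
    + by rewrite degree_split; apply: coef_homog.
    + rewrite degree_split; apply: nowhere_vanishing_generates; first exact: coef_homog.
      by rewrite /nd -pdegX coefE ?wpX_neq0 //; apply: dm_coef_lead; exact: wpX_neq0.
  rewrite /eta opprK big_mkcond big_ord_recr /= top_lt.
  have -> x : 1 + (x + h (2 * nd)%N) - h (2 * nd)%N = 1 + x by ring.
  apply: deg_ltD; first by apply: (homog_deg_lt (corank_gt0 F nd_gt0)); apply: homog1.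
  apply: deg_lt_sum => i _; case: ifP => [ndi|_]; last exact: deg_lt0.
  have [h_homog _] := hP _ ndi; apply: (homog_deg_lt _ h_homog).
  rewrite -/nd.
  have : (q ^ i < q ^ (2 * nd))%N by rewrite expn_card_ltn.
  have : (q ^ nd <= q ^ i)%N by rewrite expn_card_leq ltnW.
  by move: (q ^ i)%N (q ^ nd)%N (q ^ (2 * nd))%N => x y z; lia.
Qed.

End OrdinaryReduction.

(** * Base change of Drinfeld modules, and the canonical subgroup *)

Section BaseChangeModule.
Variables (F : finFieldType) (r : nat) (B B' : comPzRingType).
Variables (gamma : {rmorphism {poly F} -> B}) (gamma' : {rmorphism {poly F} -> B'}).
Variables (phi : {rmorphism B -> B'}).
Variables (E : drinfeld_module r gamma) (E' : drinfeld_module r gamma').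
Variables (g : {rmorphism lb_ring E -> lb_ring E'}).
Hypothesis bc : @is_base_change F r B B' gamma gamma' phi E E' g.

Lemma base_change_line_bundle : exists lam, line_bundle_base_change phi lam g.
Proof. by case: bc => lam [lamP univ gB gF _]; exists lam; split. Qed.

Lemma phi_base_change x s : g (dm_phi E x s) = dm_phi E' x (g s).
Proof. by case: bc => lam []. Qed.

Variables (sz : nat) (ch : charts sz E) (ch' : charts sz E').
Hypothesis formE : forall i, chX ch' i = g (chX ch i).
Variable lam : lb_mod E -> lb_mod E'.
Hypothesis lbc : line_bundle_base_change phi lam g.
Hypothesis vecE : forall i, ch_vec ch' i = lam (ch_vec ch i).

(** [is_base_change] constrains only the comorphisms of Phi; the coefficients follow by
    [coef_unique]. *)
Lemma coef_base_change x i : coef E' x i = g (coef E x i).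
Proof.
pose K := (maxn i (r * pdeg x)).+1.
apply: (@coef_unique _ _ _ _ E' _ ch' (coef E' x) (fun k => g (coef E x k)) K).
- by move=> k; apply: coef_homog.
- move=> k; apply: (homog_base_change lbc vecE); exact: coef_homog.
- move=> j; have xK : (r * pdeg x < K)%N by rewrite ltnS leq_maxr.
  rewrite -(phi_coord _ xK) -[lb_coord _]/(chX ch' j) formE -phi_base_change.
  by rewrite (phi_coord _ xK) rmorphM rmorph_sum.
- by rewrite ltnS leq_maxl.
Qed.

Lemma multiplier_base_change x : multiplier E' x = g (multiplier E x).
Proof. by rewrite rmorph_sum; apply: eq_bigr => i _; rewrite coef_base_change. Qed.

End BaseChangeModule.

Section CanonicalSubgroup.
Variables (F : finFieldType) (wp : {poly F}).
Hypotheses (wp_monic : wp \is monic) (wp_irr : irreducible_poly wp).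
Variables (n : nat) (n_gt0 : (0 < n)%N).
Local Notation q := #|F|.
Local Notation d := (pdeg wp).
Local Notation N1 := (q ^ (n * d) - 1)%N.
Local Notation M := (q ^ (2 * (n * d)) - q ^ (n * d))%N.

Section OneBase.
Variables (B Bbar : comPzRingType).
Variables (gamma : {rmorphism {poly F} -> B}) (gammabar : {rmorphism {poly F} -> Bbar}).
Variables (pi : {rmorphism B -> Bbar}).
Variables (E : drinfeld_module 2 gamma) (Ebar : drinfeld_module 2 gammabar).
Variables (rho : {rmorphism lb_ring E -> lb_ring Ebar}).
Hypothesis w_complete : adically_complete (gamma wp).
Hypothesis quot : is_quotient_by (gamma wp) pi.
Hypothesis bc : @is_base_change F 2 B Bbar gamma gammabar pi E Ebar rho.
Variables (sz : nat) (ch : charts sz E).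

Lemma reduction_charts : exists lam (chbar : charts sz Ebar),
  [/\ line_bundle_base_change pi lam rho,
      forall i, ch_vec chbar i = lam (ch_vec ch i) &
      forall i, chX chbar i = rho (chX ch i)].
Proof.
have [lam lbc] := base_change_line_bundle bc.
by have [chbar [vecE formE _]] := charts_base_change lbc ch; exists lam, chbar.
Qed.

(** Lifts ordinarity from the reduction to divisibility modulo w over B, a form that any base change
    visibly preserves. *)
Lemma ordinary_generates : @ordinary F wp Bbar gammabar Ebar <->
  generates_mod ch (gamma wp) (q ^ d - 1) (coef E wp d).
Proof.
have [lam [chbar [lbc vecE formE]]] := reduction_charts.
have coefbar := coef_base_change bc formE lbc vecE wp d.
have coefE_d : dm_coef Ebar wp d = rho (coef E wp d).
  by rewrite -coefbar coefE ?monic_neq0 ?leq_pmull.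
split=> [ord j|gen].
  have d_homog : homog chbar (q ^ d - 1) (dm_coef Ebar wp d).
    by rewrite coefE_d -coefbar; apply: coef_homog.
  have [b bX] := nowhere_vanishing_generates d_homog ord j.
  have [b' b'E] := quot.1 b; exists b'.
  apply/(reduction_kernel quot lbc ch).
  rewrite rmorphB rmorphM rmorphXn (bc_str lbc) -formE bX b'E coefE_d.
  exact: subrr.
apply: (generates_nowhere_vanishing (ch := chbar) (n := (q ^ d - 1)%N)) => j.
have [b /(reduction_kernel quot lbc ch)] := gen j.
rewrite rmorphB rmorphM rmorphXn (bc_str lbc) -formE -coefE_d.
by move=> /eqP; rewrite subr_eq0 => /eqP ->; exists (pi b).
Qed.

Variable eps : lb_ring E.
Hypothesis eps_can :
  canonical_idempotent ch (multiplier E (wp ^+ n)) N1 M (gamma wp) eps.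

(** Existence and uniqueness at once, relative to any idempotent with the required properties; over
    B' it is applied to the image of eps. *)
Lemma canonical_subgroupP C :
  @is_canonical_subgroup F wp n B Bbar gamma gammabar E Ebar rho C <->
  C = component (multiplier E (wp ^+ n)) eps.
Proof.
have [lam [chbar [lbc vecE formE]]] := reduction_charts.
have top := multiplier_top ch wp_monic n_gt0.
have crit C' : is_ideal C' ->
    ideal_gen (rho @` C') = @frobenius_kernel_ideal F 2 Bbar gammabar Ebar d n <->
    C' `<=` ideal_add (monomial_ideal ch N1.+1) (principal (lb_str E (gamma wp))) /\
    forall j, ideal_add C' (principal (lb_str E (gamma wp))) (chX ch j ^+ N1.+1).
  move=> C'i; rewrite (frobenius_kernel_idealE chbar) -[X in monomial_ideal chbar X](rank_order F (n * d)).
  exact: (reduction_criterion quot lbc formE).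
split=> [[[Ci IC C_free _] /(crit _ Ci)[CM XC]]|->].
  rewrite torsion_idealE in IC.
  exact: (component_unique w_complete top eps_can Ci IC C_free CM XC).
split.
  apply: (component_flf w_complete top (rank_order F (n * d)) eps_can).
  by apply: corank_gt0; rewrite muln_gt0 n_gt0 (irreducible_pdeg_gt0 wp_irr).
apply/crit; first exact: component_ideal.
by case: eps_can => _ epsM epsX _; split.
Qed.

End OneBase.
End CanonicalSubgroup.

Theorem lemma3p5 (F : finFieldType) (wp : {poly F})
    (wp_monic : wp \is monic) (wp_irr : irreducible_poly wp)
    (OK : comPzRingType) (j : {rmorphism {poly F} -> OK})
    (OK_completion : is_adic_completion wp j)
    (B : comPzRingType) (beta : {rmorphism OK -> B})
    (B_complete : adically_complete (beta (j wp)))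
    (E : drinfeld_module 2 (beta \o j))
    (Bbar : comPzRingType) (pi : {rmorphism B -> Bbar})
    (Bbar_quotient : is_quotient_by (beta (j wp)) pi)
    (Ebar : drinfeld_module 2 (pi \o (beta \o j)))
    (rho : {rmorphism lb_ring E -> lb_ring Ebar})
    (Ebar_reduction : is_base_change pi rho)
    (Ebar_ordinary : ordinary wp Ebar)
    (n : nat) (n_gt0 : (0 < n)%N) :
  (exists! C : set (lb_ring E), is_canonical_subgroup wp n rho C) /\
  (forall C : set (lb_ring E), is_canonical_subgroup wp n rho C ->
   forall (B' : comPzRingType) (beta' : {rmorphism OK -> B'}),
     adically_complete (beta' (j wp)) ->
   forall phi : {rmorphism B -> B'},
     (forall x, phi (beta x) = beta' x) ->
   forall (E' : drinfeld_module 2 (beta' \o j))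
     (g : {rmorphism lb_ring E -> lb_ring E'}),
     is_base_change phi g ->
   forall (Bbar' : comPzRingType) (pi' : {rmorphism B' -> Bbar'}),
     is_quotient_by (beta' (j wp)) pi' ->
   forall (Ebar' : drinfeld_module 2 (pi' \o (beta' \o j)))
     (rho' : {rmorphism lb_ring E' -> lb_ring Ebar'}),
     is_base_change pi' rho' ->
     ordinary wp Ebar' /\
     unique (is_canonical_subgroup wp n rho') (ideal_gen (g @` C))).
Proof.
have [sz [ch]] := charts_exist E.
have ord := (ordinary_generates (gamma := beta \o j) wp_monic Bbar_quotient Ebar_reduction ch).1 Ebar_ordinary.
have [eps eps_can] := ordinary_idempotent wp_monic wp_irr ord n_gt0 B_complete.
have canP := canonical_subgroupP (gamma := beta \o j) wp_monic wp_irr n_gt0 B_complete Bbar_quotient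
  Ebar_reduction eps_can.
split.
  exists (component (multiplier E (wp ^+ n)) eps); split; first exact/canP.
  by move=> C /canP.
move=> C /canP -> B' beta' B'_complete phi phi_beta E' g g_bc Bbar' pi' quot' Ebar' rho' bc'.
have [lam lbc] := base_change_line_bundle g_bc.
have [ch' [vecE formE _]] := charts_base_change lbc ch.
have wE : phi ((beta \o j) wp) = (beta' \o j) wp by exact: phi_beta.
(* Over B' no new idempotent is constructed: with g eps, the canonical subgroup of E' is by
   construction the base change of C. *)
have eps_can' := canonical_idempotent_base_change lbc vecE formE eps_can.
rewrite -(multiplier_base_change g_bc formE lbc vecE) wE in eps_can'.
have canP' := canonical_subgroupP (gamma := beta' \o j) wp_monic wp_irr n_gt0 B'_complete quot' bc' eps_can'.
split.
  apply/(ordinary_generates (gamma := beta' \o j) wp_monic quot' bc' ch') => i.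
  have [b Wb] := ord i; exists (phi b).
  have := principal_base_change g Wb.
  rewrite rmorphB rmorphM rmorphXn !(bc_str lbc) wE -formE.
  by rewrite -(coef_base_change g_bc formE lbc vecE).
rewrite (component_image lbc formE) -(multiplier_base_change g_bc formE lbc vecE).
split; first exact/canP'.
by move=> C' /canP' ->.
Qed.
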